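(* Let $\mathcal{X}\subset\mathbb{R}^{n_x}$, $\mathcal{Y}\subset\mathbb{R}^{n_y}$ and payoff functions $f_t$, $t=0,1,2,\ldots$, satisfy the standing assumptions (A1)–(A5) listed in the context, and suppose that for every $t\ge0$ the Nash equilibrium $(x_t^*,y_t^* )$ of $f_t$ on $\mathcal{X}\times\mathcal{Y}$ lies in the interior of $\mathcal{X}\times\mathcal{Y}$. Let $\rho\in(0,1)$, let $$\alpha\in\Big(0,\frac{2\mu}{\mu L+L_\times^2}\Big),$$ let $\{c_t\}_{t\ge0}$ be a positive sequence, let $$\delta_t=\min\Big\{\frac{c_t}{n_xL_x},\frac{c_t}{n_yL_y},\bar\delta_x,\bar\delta_y\Big\},$$ let $(x_0,y_0)\in\mathcal{X}\times\mathcal{Y}$, and let $\{(x_t,y_t)\}_{t\ge 0}$ be generated by the deterministic-difference zeroth-order descent-ascent algorithm: for $t\ge0$, $h_t^x\in\mathbb{R}^{n_x}$ and $h_t^y\in\mathbb{R}^{n_y}$ have coordinates $$h_t^x[k]=\frac{f_t(x_t+\delta_te_x^k,y_t)-f_t(x_t-\delta_te_x^k,y_t)}{2\delta_t}\ (1\le k\le n_x),\qquad h_t^y[\ell]=\frac{f_t(x_t,y_t+\delta_te_y^\ell)-f_t(x_t,y_t-\delta_te_y^\ell)}{2\delta_t}\ (1\le\ell\le n_y),$$ and $$x_{t+1}=\mathcal{P}_{\mathcal{X}}(x_t-\alpha h_t^x),\qquad y_{t+1}=\mathcal{P}_{\mathcal{Y}}(y_t+\alpha h_t^y).$$ Set $$\beta=1+\tfrac12(L^2+\mu^2+2L_\times^2)\alpha^2-(L+\mu)\alpha+\tfrac12(L-\mu)\alpha\sqrt{(L\alpha+\mu\alpha-2)^2+4L_\times^2\alpha^2}.$$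 Then for all $t\ge0$, $$\|x_t-x_t^*\|^2+\|y_t-y_t^*\|^2\le\beta^t\big(\|x_0-x_0^*\|^2+\|y_0-y_0^*\|^2\big)+\sum_{i=1}^t\beta^{t-i}\Big(2D_{\mathcal{X}}(\alpha c_{i-1}+V_i^x)+2D_{\mathcal{Y}}(\alpha c_{i-1}+V_i^y)+2\alpha^2c_{i-1}^2+(V_i^x)^2+(V_i^y)^2\Big).$$ Moreover, for every $T\ge1$ the forgetting-factor game regret satisfies $$R_T^F\le\frac L2\sum_{t=1}^T\rho^{T-t}\beta^t\big(\|x_0-x_0^*\|^2+\|y_0-y_0^*\|^2\big)+\frac L2\sum_{i=1}^T\sum_{t=i}^T\rho^{T-t}\beta^{t-i}\Big(2D_{\mathcal{X}}(\alpha c_{i-1}+V_i^x)+2D_{\mathcal{Y}}(\alpha c_{i-1}+V_i^y)+2\alpha^2c_{i-1}^2+(V_i^x)^2+(V_i^y)^2\Big).$$ In particular, if $c_t\to0$, $V_t^x\to0$ and $V_t^y\to0$ as $t\to\infty$, then $R_T^F\to0$ as $T\to\infty$.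
   Context: $\|\cdot\|$ is the Euclidean norm; $\mathcal{P}_{\mathcal{X}}(z)=\arg\min_{x\in\mathcal{X}}\|x-z\|$ is Euclidean projection onto $\mathcal{X}$ (similarly $\mathcal{P}_{\mathcal{Y}}$); $\nabla_x f,\nabla_y f$ are partial gradients; $e_x^k$ and $e_y^\ell$ are the canonical basis vectors of $\mathbb{R}^{n_x}$ and $\mathbb{R}^{n_y}$; $\mathbb{B}$ denotes the closed Euclidean unit ball (of the appropriate dimension). Standing assumptions. (A1) $\mathcal{X}$ and $\mathcal{Y}$ are nonempty, compact and convex; each $f_t$ is continuous and convex-concave on $\mathcal{X}\times\mathcal{Y}$ (convex in $x$ for each fixed $y$, concave in $y$ for each fixed $x$). (A2) There are $\mu_x,\mu_y>0$ such that each $f_t$ is $\mu_x$-strongly convex in $x\in\mathcal{X}$ for every fixed $y\in\mathcal{Y}$ and $\mu_y$-strongly concave in $y\in\mathcal{Y}$ for every fixed $x\in\mathcal{X}$. (A3) Each $f_t$ is differentiable, and there are $L_x\ge\mu_x$, $L_y\ge\mu_y$ such that $\|\nabla_x f_t(x,y)-\nabla_x f_t(x',y)\|\le L_x\|x-x'\|$ and $\|\nabla_y f_t(x,y)-\nabla_y f_t(x,y')\|\le L_y\|y-y'\|$ for all $x,x'\in\mathcal{X}$, $y,y'\in\mathcal{Y}$, $t\ge0$. (A4) There are $L_{xy},L_{yx}>0$ such that $\|\nabla_x f_t(x,y)-\nabla_x f_t(x,y')\|\le L_{xy}\|y-y'\|$ and $\|\nabla_y f_t(x,y)-\nabla_y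 f_t(x',y)\|\le L_{yx}\|x-x'\|$ for all $x,x'\in\mathcal{X}$, $y,y'\in\mathcal{Y}$, $t\ge0$. (A5) There are $\bar\delta_x,\bar\delta_y>0$ such that every $f_t$ is defined (can be queried) on the expanded domain $(\mathcal{X}+\bar\delta_x\mathbb{B})\times(\mathcal{Y}+\bar\delta_y\mathbb{B})$, and the differentiability and the Lipschitz bounds of (A3) hold on this expanded domain with the same constants $L_x,L_y$. A Nash equilibrium (NE) of $f_t$ is a pair $(x_t^*,y_t^* )\in\mathcal{X}\times\mathcal{Y}$ with $f_t(x_t^*,y)\le f_t(x_t^*,y_t^* )\le f_t(x,y_t^* )$ for all $(x,y)\in\mathcal{X}\times\mathcal{Y}$; under (A1)–(A2) it exists and is unique. Notation: $\mu=\min\{\mu_x,\mu_y\}$, $L=\max\{L_x,L_y\}$, $L_\times=\max\{L_{xy},L_{yx}\}$; $D_{\mathcal{X}}=\sup_{x,x'\in\mathcal{X}}\|x-x'\|$, $D_{\mathcal{Y}}=\sup_{y,y'\in\mathcal{Y}}\|y-y'\|$; for $t\ge1$, $V_t^x=\|x_t^*-x_{t-1}^*\|$ and $V_t^y=\|y_t^*-y_{t-1}^*\|$. Forgetting-factor game regret (for given $\rho\in(0,1)$): $R_T^F=\sum_{t=1}^T\rho^{T-t}\big(f_t(x_t,y_t^* )-f_t(x_t^*,y_t)\big)$. *)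

(* Defs.v *)
(* MathComp / MathComp-Analysis. *)
From HB Require Import structures.
From mathcomp Require Export all_boot all_order all_algebra.
From mathcomp Require Export all_classical all_reals all_analysis.
Export Order.TTheory GRing.Theory Num.Theory.
Export numFieldNormedType.Exports.

Set Implicit Arguments.
Unset Strict Implicit.
Unset Printing Implicit Defensive.

Local Open Scope classical_set_scope.
Local Open Scope ring_scope.

(* The library norm on ['rV[R]_n] is the sup norm, so the Euclidean one is
   defined here; both induce the same topology, hence the library's
   [compact], [continuous], [interior] and [=o_] keep their usual meaning. *)
Definition dotp (R : realType) (n : nat) (u v : 'rV[R]_n) : R :=
  \sum_(i < n) u ord0 i * v ord0 i.

Definition enorm (R : realType) (n : nat) (v : 'rV[R]_n) : R :=
  Num.sqrt (\sum_(i < n) v ord0 i ^+ 2).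

Definition eball (R : realType) (n : nat) : set 'rV[R]_n :=
  [set u | enorm u <= 1].
Arguments eball {R n}.

(* [A + d B], with B the closed Euclidean unit ball. *)
Definition expand (R : realType) (n : nat) (A : set 'rV[R]_n) (d : R) :
    set 'rV[R]_n :=
  [set z | exists2 a, A a & exists2 u, eball u & z = a + d *: u].

Definition diameter (R : realType) (n : nat) (A : set 'rV[R]_n) : R :=
  sup [set d | exists a a', [/\ A a, A a' & d = enorm (a - a')]].

Definition is_proj (R : realType) (n : nat) (A : set 'rV[R]_n)
    (z p : 'rV[R]_n) : Prop :=
  A p /\ forall a, A a -> enorm (p - z) <= enorm (a - z).

Definition strongly_convex (R : realType) (n : nat) (mu : R)
    (A : set 'rV[R]_n) (g : 'rV[R]_n -> R) : Prop :=
  forall (a b : 'rV[R]_n) (s : R), A a -> A b -> 0 <= s <= 1 ->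
    g (s *: a + (1 - s) *: b) <=
    s * g a + (1 - s) * g b - mu / 2 * (s * (1 - s)) * enorm (a - b) ^+ 2.

Section Payoff.
Context {R : realType} {m n : nat}.
Implicit Types (A : set 'rV[R]_m) (B : set 'rV[R]_n).
Implicit Types (f : 'rV[R]_m * 'rV[R]_n -> R).

Definition convex_concave A B f : Prop :=
  (forall y, B y -> convex_function A (fun x => f (x, y))) /\
  (forall x, A x -> convex_function B (fun y => - f (x, y))).

Definition strongly_convex_concave (mu_x mu_y : R) A B f : Prop :=
  (forall y, B y -> strongly_convex mu_x A (fun x => f (x, y))) /\
  (forall x, A x -> strongly_convex mu_y B (fun y => - f (x, y))).

(* Joint Frechet differentiability relative to [D], with partial gradients
   [gx] and [gy]: a payoff is only given on its domain, so its (arbitrary)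
   values outside [D] must not matter.  When [D] is convex with nonempty
   interior, [gx] and [gy] are uniquely determined, and at interior points
   this is ordinary differentiability. *)
Definition has_gradient (D : set ('rV[R]_m * 'rV[R]_n)) f
    (z : 'rV[R]_m * 'rV[R]_n) (gx : 'rV[R]_m) (gy : 'rV[R]_n) : Prop :=
  let F := within D (nbhs z) in
  (fun w => f w - f z - (dotp gx (w.1 - z.1) + dotp gy (w.2 - z.2)))
    =o_F (fun w => w - z).

Definition smooth_on A B f (gx : 'rV[R]_m * 'rV[R]_n -> 'rV[R]_m)
    (gy : 'rV[R]_m * 'rV[R]_n -> 'rV[R]_n) (Lx Ly : R) : Prop :=
  [/\ forall z, (A `*` B) z -> has_gradient (A `*` B) f z (gx z) (gy z),
      forall x x' y, A x -> A x' -> B y ->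
        enorm (gx (x, y) - gx (x', y)) <= Lx * enorm (x - x')
    & forall x y y', A x -> B y -> B y' ->
        enorm (gy (x, y) - gy (x, y')) <= Ly * enorm (y - y')].

Definition cross_lipschitz A B (gx : 'rV[R]_m * 'rV[R]_n -> 'rV[R]_m)
    (gy : 'rV[R]_m * 'rV[R]_n -> 'rV[R]_n) (Lxy Lyx : R) : Prop :=
  (forall x y y', A x -> B y -> B y' ->
     enorm (gx (x, y) - gx (x, y')) <= Lxy * enorm (y - y')) /\
  (forall x x' y, A x -> A x' -> B y ->
     enorm (gy (x, y) - gy (x', y)) <= Lyx * enorm (x - x')).

Definition is_nash A B f (xs : 'rV[R]_m) (ys : 'rV[R]_n) : Prop :=
  [/\ A xs, B ys &
      forall x y, A x -> B y ->
        f (xs, y) <= f (xs, ys) /\ f (xs, ys) <= f (x, ys)].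

Definition diff_x f (d : R) (x : 'rV[R]_m) (y : 'rV[R]_n) : 'rV[R]_m :=
  \row_(k < m) ((f (x + d *: delta_mx ord0 k, y)
                 - f (x - d *: delta_mx ord0 k, y)) / (2 * d)).

Definition diff_y f (d : R) (x : 'rV[R]_m) (y : 'rV[R]_n) : 'rV[R]_n :=
  \row_(l < n) ((f (x, y + d *: delta_mx ord0 l)
                 - f (x, y - d *: delta_mx ord0 l)) / (2 * d)).

Definition forgetting_regret (f : nat -> 'rV[R]_m * 'rV[R]_n -> R) (rho : R)
    (x xs : nat -> 'rV[R]_m) (y ys : nat -> 'rV[R]_n) (T : nat) : R :=
  \sum_(1 <= t < T.+1)
    rho ^+ (T - t) * (f t (x t, ys t) - f t (xs t, y t)).

End Payoff.

(* Only meaningful for [1 <= t]; the value at [t = 0] is the junk value 0. *)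
Definition variation (R : realType) (n : nat) (z : nat -> 'rV[R]_n)
    (t : nat) : R :=
  enorm (z t - z t.-1).

Definition contraction_factor (R : realType) (mu L Lc alpha : R) : R :=
  1 + 2^-1 * (L ^+ 2 + mu ^+ 2 + 2 * Lc ^+ 2) * alpha ^+ 2
  - (L + mu) * alpha
  + 2^-1 * (L - mu) * alpha
    * Num.sqrt ((L * alpha + mu * alpha - 2) ^+ 2
                + 4 * Lc ^+ 2 * alpha ^+ 2).

(* Main.v *)
(* The gradient operator F = (grad_x f, - grad_y f) vanishes at an interior
   equilibrium, so one exact descent-ascent step from z is the map z - alpha F z
   measured from that equilibrium, and the point is that this map is
   sqrt(beta)-Lipschitz.  If f were C^2, the averaged Hessian would write
   F z - F z' as (L + mu)/2 (z - z') + S (z - z') + J (z - z') with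
   |S| <= (L - mu)/2 and J skew-symmetric with |J| <= Lc, hence the Lipschitz
   constant sqrt((1 - alpha (L + mu)/2)^2 + alpha^2 Lc^2) + alpha (L - mu)/2,
   whose square is beta.  For f merely C^{1,1} there is no such averaged Hessian.
   Instead z and z' are joined by lattice staircases with alternating x- and
   y-steps.  The x-increments of grad_x f and the y-increments of - grad_y f are
   controlled by cocoercivity (a Baillon-Haddad inequality on a convex domain,
   obtained on short pieces of a segment and then summed); they make up S.  The
   cross increments P and Q make up J, and <u, P> - <v, Q> summed over a band of
   parallel staircases is a telescoping sum of discrete mixed differences of f,
   so it is negligible for at least one staircase of the band.
   The perturbations by finite differences, by projection and by the drift of the
   equilibria are then absorbed using the diameters of X and Y. *)
Require Import Defs.
From mathcomp Require Import ring lra zify.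

Set Implicit Arguments.
Unset Strict Implicit.
Unset Printing Implicit Defensive.

Local Open Scope classical_set_scope.
Local Open Scope ring_scope.

(** * Euclidean inner product and norm *)

Section Euclidean.
Context {R : realType} {n : nat}.
Implicit Types (u v w : 'rV[R]_n) (a : R).

Lemma dotpC u v : dotp u v = dotp v u.
Proof. by apply: eq_bigr => i _; rewrite mulrC. Qed.

Lemma dotpDl u v w : dotp (u + v) w = dotp u w + dotp v w.
Proof. by rewrite -big_split; apply: eq_bigr => i _; rewrite mxE mulrDl. Qed.

Lemma dotpZl a u v : dotp (a *: u) v = a * dotp u v.
Proof. by rewrite mulr_sumr; apply: eq_bigr => i _; rewrite mxE mulrA. Qed.

Lemma dotpNl u v : dotp (- u) v = - dotp u v.
Proof. by rewrite -scaleN1r dotpZl mulN1r. Qed.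

Lemma dotp0l v : dotp 0 v = 0.
Proof. by rewrite -(scale0r v) dotpZl mul0r. Qed.

Lemma dotpDr u v w : dotp w (u + v) = dotp w u + dotp w v.
Proof. by rewrite !(dotpC w) dotpDl. Qed.

Lemma dotpZr a u v : dotp u (a *: v) = a * dotp u v.
Proof. by rewrite !(dotpC u) dotpZl. Qed.

Lemma dotpNr u v : dotp u (- v) = - dotp u v.
Proof. by rewrite !(dotpC u) dotpNl. Qed.

Definition dotpE := (dotpDl, dotpDr, dotpNl, dotpNr, dotpZl, dotpZr).

Lemma dotp_sumr I (r : seq I) (F : I -> 'rV[R]_n) u :
  dotp u (\sum_(i <- r) F i) = \sum_(i <- r) dotp u (F i).
Proof.
elim: r => [|i r IH]; first by rewrite !big_nil dotpC dotp0l.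
by rewrite !big_cons dotpDr IH.
Qed.

Lemma dotp_ge0 u : 0 <= dotp u u.
Proof. by apply: sumr_ge0 => i _; rewrite -expr2 sqr_ge0. Qed.

Lemma sqr_enorm u : enorm u ^+ 2 = dotp u u.
Proof.
rewrite sqr_sqrtr; first by apply: eq_bigr => i _; rewrite expr2.
by apply: sumr_ge0 => i _; exact: sqr_ge0.
Qed.

Lemma enorm_ge0 u : 0 <= enorm u.
Proof. exact: sqrtr_ge0. Qed.

(** Cauchy-Schwarz, from nonnegativity of the square of [dotp v v *: u - dotp u v *: v]; the
    division by [dotp v v] is why [v = 0] is treated apart. *)
Lemma dotp_le_enorm u v : dotp u v <= enorm u * enorm v.
Proof.
have [v0|v0] := eqVneq (dotp v v) 0.
  suff -> : v = 0 by rewrite dotpC dotp0l mulr_ge0 ?enorm_ge0.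
  apply/rowP => i; rewrite mxE; apply/eqP; rewrite -sqrf_eq0 eq_le sqr_ge0 andbT.
  rewrite -v0 /dotp (bigD1 i) //= -expr2 lerDl.
  by apply: sumr_ge0 => j _; rewrite -expr2 sqr_ge0.
have vp : 0 < dotp v v by rewrite lt_def v0 dotp_ge0.
apply: le_trans (ler_norm _) _.
rewrite -(ler_pXn2r (n := 2)) ?nnegrE ?mulr_ge0 ?enorm_ge0 //.
rewrite real_normK ?num_real// exprMn !sqr_enorm.
have := dotp_ge0 (dotp v v *: u - dotp u v *: v).
rewrite !dotpE (dotpC v u) => h.
rewrite -subr_ge0 -(pmulr_rge0 _ vp); move: h; congr (0 <= _); ring.
Qed.

Lemma enorm0 : enorm (0 : 'rV[R]_n) = 0.
Proof. by apply/eqP; rewrite -sqrf_eq0 sqr_enorm dotp0l. Qed.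

Lemma enormZ a u : enorm (a *: u) = `|a| * enorm u.
Proof.
apply/eqP; rewrite -(eqrXn2 (n := 2)) ?mulr_ge0 ?enorm_ge0 //.
by rewrite exprMn !sqr_enorm !dotpE real_normK ?num_real // expr2 mulrA.
Qed.

Lemma enormN u : enorm (- u) = enorm u.
Proof. by rewrite -scaleN1r enormZ normrN1 mul1r. Qed.

Lemma enormB u v : enorm (u - v) = enorm (v - u).
Proof. by rewrite -enormN opprB. Qed.

Lemma enormD u v : enorm (u + v) <= enorm u + enorm v.
Proof.
rewrite -(ler_pXn2r (n := 2)) ?nnegrE ?addr_ge0 ?enorm_ge0 //.
rewrite sqrrD !sqr_enorm !dotpE (dotpC v u).
have := dotp_le_enorm u v; lra.
Qed.

Lemma enorm_sum I (r : seq I) (F : I -> 'rV[R]_n) :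
  enorm (\sum_(i <- r) F i) <= \sum_(i <- r) enorm (F i).
Proof.
elim: r => [|i r IH]; first by rewrite !big_nil enorm0.
by rewrite !big_cons (le_trans (enormD _ _)) // lerD2l.
Qed.

Lemma enorm_eq0 u : enorm u = 0 -> u = 0.
Proof.
move=> /eqP; rewrite -sqrf_eq0 sqr_enorm => /eqP u0.
apply/rowP => i; rewrite mxE; apply/eqP; rewrite -sqrf_eq0 eq_le sqr_ge0 andbT.
rewrite -u0 /dotp (bigD1 i) //= -expr2 lerDl.
by apply: sumr_ge0 => j _; rewrite -expr2 sqr_ge0.
Qed.

Lemma enorm_delta (k : 'I_n) : enorm (delta_mx ord0 k : 'rV[R]_n) = 1.
Proof.
rewrite /enorm (bigD1 k) //= big1 ?mxE ?eqxx ?expr1n ?addr0 ?sqrtr1//.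
by move=> i ik; rewrite mxE eqxx (negbTE ik) expr0n.
Qed.

Lemma dotp_delta u (k : 'I_n) : dotp u (delta_mx ord0 k) = u ord0 k.
Proof.
rewrite /dotp (bigD1 k) //= big1 ?mxE ?eqxx ?mulr1 ?addr0 //.
by move=> i ik; rewrite mxE eqxx (negbTE ik) mulr0.
Qed.

(** The factor [n], coarser than sqrt n, is the one compensated by a difference step of size at most
    c / (n L). *)
Lemma enorm_le_bound u a : 0 <= a -> (forall i, `|u ord0 i| <= a) ->
  enorm u <= n%:R * a.
Proof.
move=> a0 ua; rewrite -(ler_pXn2r (n := 2)) ?nnegrE ?enorm_ge0 ?mulr_ge0 //.
rewrite sqr_enorm; apply: (@le_trans _ _ (\sum_(i < n) a ^+ 2)).
  apply: ler_sum => i _; rewrite -expr2 -[X in X <= _](real_normK (num_real _)).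
  by rewrite ler_pXn2r // nnegrE.
rewrite sumr_const card_ord -[leLHS]mulr_natl exprMn ler_wpM2r ?sqr_ge0 //.
by rewrite -natrX ler_nat; case: (n) => // k; rewrite expnS expn1 leq_pmulr.
Qed.

Lemma norm_le_enorm u : `|u| <= enorm u.
Proof.
rewrite {1}/Num.norm /= mx_normrE; apply/bigmax_leP; split => [|[i j] _].
  exact: enorm_ge0.
rewrite /= (ord1 i) -(ler_pXn2r (n := 2)) ?nnegrE ?enorm_ge0 //.
rewrite real_normK ?num_real // sqr_enorm /dotp (bigD1 j) //= -expr2 lerDl.
by apply: sumr_ge0 => k _; rewrite -expr2 sqr_ge0.
Qed.

Lemma enorm_le_norm u : enorm u <= n%:R * `|u|.
Proof.
apply: enorm_le_bound => // i.
by rewrite {2}/Num.norm /= mx_normrE; exact: (le_bigmax _ _ (ord0, i)).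
Qed.

End Euclidean.

(** A mean value inequality for a function known only on [0, 1]: the derivative is relative to that
    interval, hence one-sided at its ends. A majorant of the derivative that is affine in [s]
    integrates to [p + q / 2]. *)
Lemma secant_le {R : realType} (h dh : R -> R) (p q : R) :
  (forall s : R, 0 <= s <= 1 -> forall e : R, 0 < e -> exists2 d : R, 0 < d &
     forall t : R, 0 <= t <= 1 -> `|t - s| < d ->
       `|h t - h s - dh s * (t - s)| <= e * `|t - s|) ->
  (forall s : R, 0 <= s <= 1 -> dh s <= p + q * s) ->
  h 1 - h 0 <= p + q / 2.
Proof.
move=> h_diff dh_le.
have h_cvg (s : R) : 0 <= s <= 1 -> h @ within `[(0 : R), 1]%classic (nbhs s) --> h s.
  move=> s01; apply/cvgrPdist_le => e e0.
  (* With tolerance 1 the differentiability bound gives [|h t - h s| <= (1 + |dh s|) |t - s|] near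
     [s], hence continuity. *)
  have [d d0 hd] := h_diff s s01 1 ltr01.
  have m0 : 0 < 1 + `|dh s| by rewrite ltr_wpDr.
  near=> t.
  have td : `|t - s| < d.
    rewrite distrC; near: t; apply: cvg_within.
    by apply/nbhs_ballP; exists d => // z; rewrite /ball /=.
  have te : `|t - s| <= e / (1 + `|dh s|).
    rewrite distrC ltW //; near: t; apply: cvg_within.
    apply/nbhs_ballP; exists (e / (1 + `|dh s|)); first exact: divr_gt0.
    by move=> z; rewrite /ball /=.
  have t01 : 0 <= t <= 1.
    suff : `[(0 : R), 1]%classic t by rewrite /= in_itv.
    by near: t; exact: withinT.
  rewrite distrC.
  have -> : h t - h s = (h t - h s - dh s * (t - s)) + dh s * (t - s).
    by rewrite subrK.
  apply: le_trans (ler_normD _ _) _; rewrite normrM.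
  apply: le_trans (lerD (hd _ t01 td) (lexx _)) _.
  by rewrite -mulrDl mulrC -ler_pdivlMr.
have h_der (s : R) : s \in `]0, 1[ -> is_derive s (1 : R) h (dh s).
  rewrite in_itv /= => /andP[s0 s1].
  suff H : (fun t => t^-1 *: (h (t *: (1 : R) + s) - h s)) @ 0^' --> dh s.
    apply: DeriveDef; first by apply/cvg_ex; exists (dh s).
    exact/cvg_lim.
  apply/cvgrPdist_le => e e0.
  have [|d d0 hd] := h_diff s _ e e0; first by rewrite !ltW.
  near=> t.
  have t0 : t != 0 by near: t; exact: nbhs_dnbhs_neq.
  have td : `|t| < d by near: t; exact: dnbhs0_lt.
  (* Small increments keep [t + s] in [0, 1], so the relative derivative is an ordinary one inside
     the interval. *)
  have ts : `|t| < s by near: t; exact: dnbhs0_lt.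
  have ts1 : `|t| < 1 - s by near: t; apply: dnbhs0_lt; rewrite subr_gt0.
  have e1 : t + s - s = t by rewrite addrK.
  have := hd (t + s); rewrite e1 => /(_ _ td) H.
  rewrite /GRing.scale /= mulr1 distrC -(ler_pM2r (x := `|t|)) ?normr_gt0 //.
  rewrite -normrM mulrBl mulrAC mulVf // mul1r; apply: H.
  move: ts ts1; rewrite !ltr_norml; lra.
(* The integral of the majorant is subtracted, so [k] has nonpositive derivative and decreases from
   0 to 1. *)
pose k (r : R) := h r - p * r - q / 2 * r ^+ 2.
have k_der (s : R) : s \in `]0, 1[ -> is_derive s (1 : R) k (dh s - p - q * s).
  move=> s01; have h_s := h_der s s01.
  by rewrite /k; apply: is_derive_eq; rewrite /GRing.scale /=; field.
have k_cvg (s : R) : 0 <= s <= 1 -> k @ within `[(0 : R), 1]%classic (nbhs s) --> k s.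
  move=> s01; apply: cvgB; first (apply: cvgB; first exact: h_cvg).
    by apply: cvgM; [exact: cvg_cst | exact: cvg_within].
  by apply: cvgM; [exact: cvg_cst | rewrite expr2; apply: cvgM; exact: cvg_within].
have : k 1 <= k 0.
  apply: (ler0_derive1_le_cc (a := 0) (b := 1) (f := k)) => //.
  - by move=> s /k_der ?.
  - move=> s s01; have h_s := k_der s s01.
    rewrite derive1E (derive_val (is_derive := h_s)).
    by move: s01; rewrite in_itv /= => /andP[s0 s1]; have := dh_le s; lra.
  - apply/subspace_continuousP => s; rewrite /= in_itv /= => s01.
    exact: k_cvg.
  - by rewrite in_itv /= ler01 lexx.
  - by rewrite in_itv /= ler01 lexx.
rewrite /k; lra.
Unshelve. all: by end_near.
Qed.

(** * Quadratic bounds from gradients *)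

(** Frechet differentiability relative to [A], written with epsilons and the Euclidean norm: no
    value of [phi] outside [A] enters, and boundary points of [A] are allowed. *)
Definition gradient_on (R : realType) (n : nat) (A : set 'rV[R]_n)
    (phi : 'rV[R]_n -> R) (g : 'rV[R]_n -> 'rV[R]_n) : Prop :=
  forall a, A a -> forall e, 0 < e -> exists2 d, 0 < d &
    forall b, A b -> enorm (b - a) < d ->
      `|phi b - phi a - dotp (g a) (b - a)| <= e * enorm (b - a).

Section Slices.
Context {R : realType} {m n : nat}.
Variables (A : set 'rV[R]_m) (B : set 'rV[R]_n) (f : 'rV[R]_m * 'rV[R]_n -> R).
Variables (gx : 'rV[R]_m * 'rV[R]_n -> 'rV[R]_m).
Variables (gy : 'rV[R]_m * 'rV[R]_n -> 'rV[R]_n).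
Hypothesis f_grad :
  forall z, (A `*` B) z -> has_gradient (A `*` B) f z (gx z) (gy z).

Lemma has_gradient_eps a b e : A a -> B b -> 0 < e ->
  exists2 d, 0 < d & forall a' b', A a' -> B b' ->
    `|a' - a| < d -> `|b' - b| < d ->
    `|f (a', b') - f (a, b)
      - (dotp (gx (a, b)) (a' - a) + dotp (gy (a, b)) (b' - b))|
    <= e * Num.max `|a' - a| `|b' - b|.
Proof.
move=> Aa Bb e0; have /eqoP/(_ e e0) := f_grad (z := (a, b)) (conj Aa Bb).
move=> /nbhs_ballP[d /= d0 H]; exists d => // a' b' Aa' Bb' aa bb.
apply: (H (a', b')) => //; split => /=; rewrite -ball_normE /ball_ /= distrC //.
Qed.

Lemma gradient_on_fst b : B b ->
  gradient_on A (fun x => f (x, b)) (fun x => gx (x, b)).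
Proof.
move=> Bb a Aa e e0; have [d d0 H] := has_gradient_eps Aa Bb e0.
exists d => // a' Aa' aa; have := H a' b Aa' Bb.
rewrite subrr normr0 (dotpC (gy _)) dotp0l addr0 => /(_ _ d0) H'.
apply: le_trans (H' _) _; first exact: le_lt_trans (norm_le_enorm _) aa.
by rewrite ler_wpM2l ?(ltW e0) // ge_max norm_le_enorm enorm_ge0.
Qed.

Lemma gradient_on_snd a : A a ->
  gradient_on B (fun y => f (a, y)) (fun y => gy (a, y)).
Proof.
move=> Aa b Bb e e0; have [d d0 H] := has_gradient_eps Aa Bb e0.
exists d => // b' Bb' bb; have := H a b' Aa Bb'.
rewrite subrr normr0 (dotpC (gx _)) dotp0l add0r => /(_ d0) H'.
apply: le_trans (H' _) _; first exact: le_lt_trans (norm_le_enorm _) bb.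
by rewrite ler_wpM2l ?(ltW e0) // ge_max norm_le_enorm enorm_ge0.
Qed.

End Slices.

Section Gradient.
Context {R : realType} {n : nat}.
Implicit Types (A : set 'rV[R]_n) (phi : 'rV[R]_n -> R).
Implicit Types (g : 'rV[R]_n -> 'rV[R]_n).

Lemma gradient_onN A phi g :
  gradient_on A phi g -> gradient_on A (fun x => - phi x) (fun x => - g x).
Proof.
move=> H a Aa e e0; have [d d0 Hd] := H a Aa e e0; exists d => // b Ab ab.
by rewrite dotpNl -!opprD normrN; exact: Hd.
Qed.

Lemma convex_setE A : convex_set A -> forall (a b : 'rV[R]_n) (s : R),
  A a -> A b -> 0 <= s <= 1 -> A (a + s *: (b - a)).
Proof.
move=> cA a b s Aa Ab s01.
have -> : a + s *: (b - a) = s *: b + (1 - s) *: a.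
  by rewrite scalerBr scalerBl scale1r addrCA addrA.
have /andP[s0 s1] := s01.
(* The library's convexity quantifies over weights of an interval type, so [s] is packed into that
   type. *)
have H : Itv.spec (@Itv.num_sem R) (Itv.Real `[0%Z, 1%Z]) s.
  by rewrite /Itv.num_sem /= num_real in_itv /= s0 s1.
have := cA b a (Itv.mk H); rewrite !inE; exact.
Qed.

(** The descent lemma, from [secant_le] along the segment. Only the segment has to lie in [A], so
    that the bound also serves on the expanded domain, where finite differences are taken. *)
Lemma gradient_upper A phi g L (a b : 'rV[R]_n) :
  gradient_on A phi g ->
  (forall x y, A x -> A y -> enorm (g x - g y) <= L * enorm (x - y)) ->
  (forall s : R, 0 <= s <= 1 -> A (a + s *: (b - a))) ->
  phi b - phi a <= dotp (g a) (b - a) + L / 2 * enorm (b - a) ^+ 2.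
Proof.
move=> phi_g g_lip Aab; set u := b - a.
have Aa : A a by rewrite -(addr0 a) -(scale0r u); apply: Aab; rewrite lexx ler01.
have := @secant_le R (fun s => phi (a + s *: u))
  (fun s => dotp (g (a + s *: u)) u) (dotp (g a) u) (L * enorm u ^+ 2).
rewrite scale1r scale0r addr0 /u (addrC a) subrK mulrAC; apply => s s01.
  (* Dividing by [1 + enorm u] rather than [enorm u] covers the degenerate case [u = 0]. *)
  move=> e e0; have pu : 0 < 1 + enorm u by rewrite ltr_wpDr ?enorm_ge0.
  have [|d d0 H] := phi_g _ (Aab s s01) (e / (1 + enorm u)).
    exact: divr_gt0.
  exists (d / (1 + enorm u)); first exact: divr_gt0.
  move=> t t01 ts; have E : a + t *: u - (a + s *: u) = (t - s) *: u.
    by rewrite scalerBl opprD addrACA subrr add0r.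
  have := H _ (Aab t t01); rewrite E enormZ dotpZr [_ * (t - s)]mulrC => H'.
  apply: le_trans (H' _) _.
    rewrite ltr_pdivlMr // in ts; apply: le_lt_trans ts.
    by rewrite ler_wpM2l // lerDr.
  rewrite mulrCA mulrC ler_wpM2r // mulrAC ler_pdivrMr // ler_wpM2l ?(ltW e0) //.
  by rewrite lerDr.
have /andP[s0 _] := s01.
rewrite -[X in X <= _](subrK (dotp (g a) u)) addrC lerD2l.
have -> : dotp (g (a + s *: u)) u - dotp (g a) u
    = dotp (g (a + s *: u) - g a) u by rewrite !dotpE.
apply: le_trans (dotp_le_enorm _ _) _.
have := g_lip _ _ (Aab s s01) Aa; rewrite (addrC a) addrK enormZ (ger0_norm s0).
move=> h; apply: le_trans (ler_wpM2r (enorm_ge0 _) h) _.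
by rewrite le_eqVlt; apply/orP; left; apply/eqP; ring.
Qed.

Lemma gradient_quadratic A phi g L (a b : 'rV[R]_n) :
  gradient_on A phi g ->
  (forall x y, A x -> A y -> enorm (g x - g y) <= L * enorm (x - y)) ->
  (forall s : R, 0 <= s <= 1 -> A (a + s *: (b - a))) ->
  `|phi b - phi a - dotp (g a) (b - a)| <= L / 2 * enorm (b - a) ^+ 2.
Proof.
move=> phi_g g_lip Aab; have h1 := gradient_upper phi_g g_lip Aab.
have gN_lip x y : A x -> A y -> enorm (- g x - - g y) <= L * enorm (x - y).
  by rewrite -opprD enormN; exact: g_lip.
have h2 := gradient_upper (gradient_onN phi_g) gN_lip Aab.
rewrite ler_norml; move: h1 h2; rewrite dotpNl; lra.
Qed.

(** Strong convexity between [a] and [a + s u], divided by [s], with [s] tending to 0. *)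
Lemma strongly_convex_gradient A phi g mu (a b : 'rV[R]_n) :
  0 <= mu -> (forall s : R, 0 <= s <= 1 -> A (a + s *: (b - a))) ->
  gradient_on A phi g -> strongly_convex mu A phi ->
  phi a + dotp (g a) (b - a) + mu / 2 * enorm (b - a) ^+ 2 <= phi b.
Proof.
move=> mu0 Aab phi_g sc; set u := b - a.
have Aa : A a by rewrite -(addr0 a) -(scale0r u); apply: Aab; rewrite lexx ler01.
have Ab : A b.
  have -> : b = a + 1 *: u by rewrite scale1r addrC subrK.
  by apply: Aab; rewrite lexx ler01.
apply/ler_addgt0Pr => e e0.
set w := 1 + enorm u; have w1 : 1 <= w by rewrite lerDl enorm_ge0.
have w0 : 0 < w by exact: lt_le_trans w1.
have uw : enorm u <= w by rewrite lerDr.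
have [|d d0 H] := phi_g a Aa (e / 2 / w); first by rewrite !divr_gt0.
pose q := 1 + mu * enorm u ^+ 2.
have q0 : 0 < q by rewrite ltr_wpDr // mulr_ge0 // sqr_ge0.
(* The second bound brings [a + s u] within [d] of [a]; the third makes the curvature lost,
   [s * mu * |u|^2], at most [e]. Half of it and half of [e] from the gradient error add up to
   [e]. *)
pose s := Num.min 1 (Num.min (d / 2 / w) (e / q)).
have s0 : 0 < s by rewrite !lt_min ltr01 !divr_gt0.
have s1 : s <= 1 by rewrite ge_min lexx.
have sd : s <= d / 2 / w by rewrite !ge_min lexx orbT.
have se : s <= e / q by rewrite !ge_min lexx !orbT.
have s01 : 0 <= s <= 1 by rewrite (ltW s0) s1.
have E : a + s *: u - a = s *: u by rewrite addrC addKr.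
have := H _ (Aab s s01); rewrite E enormZ (gtr0_norm s0) dotpZr.
have su : s * enorm u <= d / 2.
  by apply: le_trans (ler_wpM2l (ltW s0) uw) _; rewrite -ler_pdivlMr.
have -> : (s * enorm u < d) = true by lra.
move=> /(_ isT); rewrite ler_norml => /andP[h _].
have := sc b a s Ab Aa s01.
have -> : s *: b + (1 - s) *: a = a + s *: u.
  by rewrite scalerBr scalerBl scale1r addrCA addrA.
rewrite -/u => h2.
have h3 : e / 2 / w * (s * enorm u) <= s * (e / 2).
  rewrite mulrCA ler_wpM2l ?(ltW s0) // mulrAC ler_pdivrMr // ler_wpM2l //; lra.
have h4 : s * (mu * enorm u ^+ 2) <= e.
  rewrite ler_pdivlMr // in se; apply: le_trans se; rewrite ler_wpM2l ?(ltW s0) //.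
  by rewrite /q; lra.
set N := enorm u ^+ 2 in h2 h4 *.
rewrite -(ler_pM2l s0).
have : s * (s * (mu * N)) <= s * e by rewrite ler_pM2l.
lra.
Qed.

End Gradient.

(** * Cocoercivity on a convex domain *)

Lemma ler_addgt0_scaled (R : realType) (p q C : R) :
  0 <= C -> (forall e : R, 0 < e <= 1 -> p <= q + C * e) -> p <= q.
Proof.
move=> C0 H; apply/ler_addgt0Pr => e e0.
have C1 : 0 < C + 1 by rewrite ltr_wpDl.
pose d := Num.min 1 (e / (C + 1)).
have d0 : 0 < d by rewrite lt_min ltr01 divr_gt0.
have d1 : d <= 1 by rewrite ge_min lexx.
have de : d <= e / (C + 1) by rewrite ge_min lexx orbT.
have /H h : 0 < d <= 1 by rewrite d0.
apply: le_trans h _; rewrite lerD2l; rewrite ler_pdivlMr // in de.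
by apply: le_trans de; rewrite mulrDr mulr1 mulrC lerDl ltW.
Qed.

Section Cocoercive.
Context {R : realType} {n : nat}.
Variables (A : set 'rV[R]_n) (phi : 'rV[R]_n -> R) (g : 'rV[R]_n -> 'rV[R]_n).
Variables (mu L : R).
Hypothesis mu_ge0 : 0 <= mu.
Hypothesis mu_le_L : mu <= L.
Hypothesis phi_upper : forall a b, A a -> A b ->
  phi b <= phi a + dotp (g a) (b - a) + L / 2 * enorm (b - a) ^+ 2.
Hypothesis phi_lower : forall a b, A a -> A b ->
  phi a + dotp (g a) (b - a) + mu / 2 * enorm (b - a) ^+ 2 <= phi b.
Hypothesis g_lip : forall a b, A a -> A b ->
  enorm (g a - g b) <= L * enorm (a - b).

(* The gradient step from [a] for [phi - <g b, .> - mu/2 |. - b|^2], which is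
   minimal at [b]. *)
Lemma cocoercive_gap (M : R) a b (D := g a - g b - mu *: (a - b)) :
  0 < M -> L - mu <= M -> A a -> A b -> A (a - M^-1 *: D) ->
  M^-1 / 2 * dotp D D
  <= phi a - phi b - dotp (g b) (a - b) - mu / 2 * enorm (a - b) ^+ 2.
Proof.
move=> M0 LM Aa Ab Az.
have h1 := phi_upper Aa Az; have h2 := phi_lower Ab Az.
set t := M^-1 in Az h1 h2 *.
have t0 : 0 < t by rewrite invr_gt0.
have tM : (L - mu) * t <= 1 by rewrite ler_pdivrMr // mul1r.
set u := a - b in D Az h1 h2 *.
have E1 : a - t *: D - a = - (t *: D) by rewrite addrC addKr.
have E2 : a - t *: D - b = u - t *: D by rewrite addrAC.
have key : dotp (g a) D - dotp (g b) D - mu * dotp u D = dotp D D.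
  by rewrite -[RHS]/(dotp (g a - g b - mu *: u) D) (dotpDl (g a - g b))
    (dotpDl (g a)) !dotpNl dotpZl.
have h3 : (L - mu) * t * (t * dotp D D) <= t * dotp D D.
  by rewrite -[leRHS]mul1r ler_wpM2r // mulr_ge0 ?dotp_ge0 // ltW.
move: h1 h2; rewrite E1 E2 !sqr_enorm; clearbody D u.
rewrite !dotpE (dotpC D u).
have h4 : t * (dotp (g a) D - dotp (g b) D - mu * dotp u D) = t * dotp D D.
  by rewrite key.
lra.
Qed.

(** Adding the gap inequality for [(a, b)] and for [(b, a)] cancels the values of [phi] and leaves
    [|D|^2 <= M <D, a - b>]. Completing the square puts [D] in the ball with centre [M / 2 (a - b)]
    and radius [M / 2 |a - b|]. *)
Lemma cocoercive_local (M : R) a b (D := g a - g b - mu *: (a - b)) :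
  0 < M -> L - mu <= M -> A a -> A b ->
  A (a - M^-1 *: D) -> A (b + M^-1 *: D) ->
  enorm (D - (M / 2) *: (a - b)) <= M / 2 * enorm (a - b).
Proof.
move=> M0 LM Aa Ab Az Az'.
have h1 := cocoercive_gap M0 LM Aa Ab Az.
have ED : g b - g a - mu *: (b - a) = - D.
  by rewrite /D; apply/rowP => i; rewrite !mxE; ring.
have := @cocoercive_gap M b a M0 LM Ab Aa; rewrite ED scalerN opprK => /(_ Az').
rewrite -(opprB a b) enormN dotpNl !dotpNr !opprK -/D => h2.
have h3 : M^-1 * dotp D D <= dotp D (a - b).
  have -> : dotp D (a - b)
      = dotp (g a) (a - b) - dotp (g b) (a - b) - mu * enorm (a - b) ^+ 2.
    by rewrite sqr_enorm /D dotpDl dotpDl !dotpNl dotpZl.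
  lra.
rewrite ler_pdivrMl // in h3.
rewrite -(ler_pXn2r (n := 2)) ?nnegrE ?mulr_ge0 ?enorm_ge0 ?divr_ge0 ?(ltW M0) //.
rewrite exprMn !sqr_enorm; clearbody D.
have -> : dotp (D - (M / 2) *: (a - b)) (D - (M / 2) *: (a - b))
   = dotp D D - M * dotp D (a - b) + (M / 2) ^+ 2 * dotp (a - b) (a - b).
  by move: (a - b) => u; rewrite !dotpE (dotpC u D); field.
lra.
Qed.

(** Removing the middle slope [mu + M / 2] turns cocoercivity into a Lipschitz bound, a form that
    adds up along a subdivided segment. *)
Local Notation G M x := (g x - (mu + M / 2) *: x).

Lemma shifted_gradientB M a b : G M a - G M b
  = g a - g b - mu *: (a - b) - (M / 2) *: (a - b).
Proof.
by apply/rowP => i; rewrite !mxE; ring.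
Qed.

(** The auxiliary gradient steps of [cocoercive_local] must stay in [A]. On a piece of a fine
    subdivision they are shorter than [r], and the bounds on the pieces add up by the triangle
    inequality. *)
Lemma cocoercive_deep (M r : R) (a b : 'rV[R]_n) :
  0 < M -> L - mu <= M -> 0 < r ->
  (forall (s : R) (z : 'rV[R]_n), 0 <= s <= 1 -> enorm (z - (a + s *: (b - a))) < r -> A z) ->
  enorm (G M b - G M a) <= M / 2 * enorm (b - a).
Proof.
move=> M0 LM r0 deep; set u := b - a.
have lm0 : 0 <= L + mu by rewrite addr_ge0 // (le_trans mu_ge0).
(* [C / N] bounds the auxiliary step on one of [N] equal pieces, since [|D| <= (L + mu) |u| / N]
   there. *)
pose C := M^-1 * ((L + mu) * enorm u).
have C0 : 0 <= C by rewrite !mulr_ge0 ?invr_ge0 ?enorm_ge0 // ltW.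
pose N := (Num.trunc (C / r)).+1.
have N0 : 0 < N%:R :> R by rewrite ltr0n.
have CN : C < r * N%:R by rewrite mulrC -ltr_pdivrMr //; exact: truncnS_gt.
pose p i := a + (i%:R / N%:R) *: u.
have i01 i : (i <= N)%N -> 0 <= (i%:R / N%:R : R) <= 1.
  move=> iN; apply/andP; split; first by rewrite divr_ge0.
  by rewrite ler_pdivrMr // mul1r ler_nat.
have Ap i : (i <= N)%N -> A (p i).
  by move=> iN; apply: (deep _ _ (i01 _ iN)); rewrite subrr enorm0.
have pS i : p i.+1 - p i = N%:R^-1 *: u.
  rewrite /p opprD addrACA subrr add0r -scalerBl -mulrBl mulrSr.
  by rewrite addrAC subrr add0r mul1r.
have step i : (i < N)%N ->
    enorm (G M (p i.+1) - G M (p i)) <= M / 2 * (N%:R^-1 * enorm u).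
  move=> iN; have Ai := Ap _ (ltnW iN); have Ai1 := Ap _ iN.
  rewrite shifted_gradientB.
  have Db : enorm (M^-1 *: (g (p i.+1) - g (p i) - mu *: (p i.+1 - p i))) < r.
    rewrite enormZ ger0_norm ?invr_ge0 ?(ltW M0) //.
    apply: (@le_lt_trans _ _ (C / N%:R)); last by rewrite ltr_pdivrMr.
    rewrite /C -mulrA ler_wpM2l ?invr_ge0 ?(ltW M0) //.
    apply: le_trans (enormD _ _) _; rewrite enormN enormZ (ger0_norm mu_ge0).
    apply: le_trans (lerD (g_lip Ai1 Ai) (lexx _)) _.
    rewrite -mulrDl pS enormZ ger0_norm ?invr_ge0 // [N%:R^-1 * _]mulrC.
    by rewrite mulrA.
  have eN : N%:R^-1 * enorm u = enorm (p i.+1 - p i).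
    by rewrite pS enormZ ger0_norm ?invr_ge0.
  rewrite eN; apply: cocoercive_local => //.
    apply: (deep _ _ (i01 _ iN)); rewrite -/u -/(p _).
    by rewrite addrC addKr enormN.
  apply: (deep _ _ (i01 _ (ltnW iN))); rewrite -/u -/(p _).
  by rewrite addrC addKr.
have <- : p N = b by rewrite /p divff ?gt_eqF // scale1r addrC subrK.
have <- : p 0%N = a by rewrite /p mul0r scale0r addr0.
rewrite -(telescope_sumr (fun i => G M (p i)) (leq0n N)).
apply: le_trans (enorm_sum _ _) _; rewrite big_mkord.
apply: (@le_trans _ _ (\sum_(i < N) M / 2 * (N%:R^-1 * enorm u))).
  by apply: ler_sum => i _; exact: step.
rewrite sumr_const card_ord -[leLHS]mulr_natl [leLHS]mulrCA (mulrA N%:R).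
by rewrite divff ?gt_eqF // mul1r.
Qed.

(** The segment may touch the boundary of [A]. Shrinking it towards [c] by a factor [1 - t] gives it
    a neighbourhood of radius [t r] inside [A]; then [t] tends to 0. *)
Lemma cocoercive_gradient (c : 'rV[R]_n) (r : R) :
  convex_set A -> 0 < r -> (forall z, enorm (z - c) < r -> A z) ->
  forall a b, A a -> A b ->
  enorm (g b - g a - ((L + mu) / 2) *: (b - a)) <= (L - mu) / 2 * enorm (b - a).
Proof.
move=> cA r0 cr a b Aa Ab; have m0 := mu_ge0; have ml := mu_le_L; set u := b - a.
have L0 : 0 <= L by exact: le_trans mu_le_L.
have cA' := convex_setE cA.
have Ac : A c by apply: cr; rewrite subrr enorm0.
apply: (@ler_addgt0_scaled _ _ _ (enorm u)); first exact: enorm_ge0.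
(* The extra [e] keeps [M] positive when [mu = L]. *)
move=> e /andP[e0 _]; set M := L - mu + e.
have M0 : 0 < M by rewrite /M; lra.
have GM : enorm (G M b - G M a) <= M / 2 * enorm u.
  pose l := L + (mu + M / 2).
  have l0 : 0 <= l by rewrite /l; lra.
  have G_lip x y : A x -> A y -> enorm (G M x - G M y) <= l * enorm (x - y).
    move=> Ax Ay; rewrite shifted_gradientB -addrA -opprD -scalerDl.
    apply: le_trans (enormD _ _) _; rewrite enormN enormZ /l [leRHS]mulrDl.
    rewrite [`|mu + _|]ger0_norm; last by lra.
    by rewrite lerD2r; exact: g_lip.
  have w0 : 0 <= enorm (c - a) + enorm (c - b) by rewrite addr_ge0 ?enorm_ge0.
  apply: (@ler_addgt0_scaled _ _ _ (l * (enorm (c - a) + enorm (c - b)))).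
    by rewrite mulr_ge0.
  move=> t /andP[t0 t1].
  have t01 : 0 <= t <= 1 by rewrite ltW.
  pose a' := a + t *: (c - a); pose b' := b + t *: (c - b).
  have Aa' : A a' by exact: cA'.
  have Ab' : A b' by exact: cA'.
  have bau : b' - a' = (1 - t) *: u.
    rewrite /b' /a' /u; apply/rowP => i; rewrite !mxE; ring.
  have deep : forall (s : R) (z : 'rV[R]_n), 0 <= s <= 1 ->
      enorm (z - (a' + s *: (b' - a'))) < t * r -> A z.
    move=> s z s01 zr.
    pose p := a + s *: u; have Ap : A p by exact: cA'.
    set w := z - _ in zr.
    (* A point near the shrunken segment is a convex combination of a point of the original segment
       and a point of the ball around [c]. *)
    have -> : z = p + t *: ((c + t^-1 *: w) - p).
      have tn0 : t != 0 by rewrite gt_eqF.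
      by rewrite /w bau /p /a' /u; apply/rowP => i; rewrite !mxE; field.
    apply: cA' => //; apply: cr; rewrite addrC addKr enormZ.
    by rewrite gtr0_norm ?invr_gt0 // ltr_pdivrMl.
  have h := @cocoercive_deep M (t * r) a' b' M0 _ _ deep.
  have {}h : enorm (G M b' - G M a') <= M / 2 * enorm u.
    apply: le_trans (h _ _) _; [by rewrite /M; lra | by rewrite mulr_gt0 |].
    rewrite ler_wpM2l ?divr_ge0 ?(ltW M0) // bau enormZ ger0_norm ?subr_ge0 //.
    by rewrite ler_piMl ?enorm_ge0 //; lra.
  have -> : G M b - G M a
      = (G M b' - G M a') + ((G M b - G M b') + (G M a' - G M a)).
    by apply/rowP => i; rewrite !mxE; ring.
  apply: le_trans (enormD _ _) _; apply: lerD => //.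
  apply: le_trans (enormD _ _) _.
  apply: le_trans (lerD (G_lip _ _ Ab Ab') (G_lip _ _ Aa' Aa)) _.
  rewrite -mulrDr -[leRHS]mulrA ler_wpM2l // /a' /b' (addrC a) addrK.
  rewrite opprD addrA subrr add0r enormN !enormZ (gtr0_norm t0).
  by rewrite -mulrDr mulrC addrC.
have -> : g b - g a - ((L + mu) / 2) *: u = (G M b - G M a) + (e / 2) *: u.
  by rewrite shifted_gradientB /M /u; apply/rowP => i; rewrite !mxE; field.
apply: le_trans (enormD _ _) _; rewrite enormZ gtr0_norm ?divr_gt0 //.
apply: le_trans (lerD GM (lexx _)) _; rewrite -mulrDl [_ * e]mulrC -mulrDl.
by rewrite /M le_eqVlt; apply/orP; left; apply/eqP; field.
Qed.

End Cocoercive.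

(** * Staircases and the contraction estimate *)

(* [h * a] and [h * b] are the first differences of [F] up to errors [E1], [E2];
   the exact differences cancel as equal mixed second differences, and the errors
   telescope across the band, leaving only O(N + K) of the N * K terms. *)
Lemma staircase_sum (R : realType) (a b F : nat -> nat -> R) (h e : R)
    (N K : nat) :
  (forall i j, (i < N + K)%N -> (j <= N + K)%N ->
     `|F i.+1 j - F i j - h * a i.+1 j| <= e) ->
  (forall i j, (i <= N + K)%N -> (j < N + K)%N ->
     `|F i j.+1 - F i j - h * b i j| <= e) ->
  `|h * \sum_(0 <= k < K) \sum_(0 <= i < N)
      (a (i + k).+1 i.+1 - a (i + k).+1 i - (b (i + k).+1 i - b (i + k)%N i))|
  <= (4 * N + 2 * K)%N%:R * e.
Proof.
move=> Fa Fb.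
pose E1 i j := h * a i.+1 j - (F i.+1 j - F i j).
pose E2 i j := h * b i j - (F i j.+1 - F i j).
have E1e i j : (i < N + K)%N -> (j <= N + K)%N -> `|E1 i j| <= e.
  by move=> iM jM; rewrite /E1 distrC; exact: Fa.
have E2e i j : (i <= N + K)%N -> (j < N + K)%N -> `|E2 i j| <= e.
  by move=> iM jM; rewrite /E2 distrC; exact: Fb.
have -> : h * \sum_(0 <= k < K) \sum_(0 <= i < N)
      (a (i + k).+1 i.+1 - a (i + k).+1 i - (b (i + k).+1 i - b (i + k)%N i))
  = \sum_(0 <= i < N) (E1 i i.+1 - E1 (i + K)%N i.+1)
    + \sum_(0 <= k < K) (E1 (N + k)%N N - E1 k 0%N)
    - \sum_(0 <= i < N) (E2 (i + K)%N i - E2 i i).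
  (* The [E1] difference at fixed first index does not telescope by itself. Inserting
     [E1 (i.+1 + k) i.+1] splits it into a difference in [k] and a diagonal one in [i], both
     telescoping. *)
  transitivity (\sum_(0 <= k < K) \sum_(0 <= i < N)
      (- (E1 (i + k.+1)%N i.+1 - E1 (i + k)%N i.+1)
       + (E1 (i.+1 + k)%N i.+1 - E1 (i + k)%N i)
       - (E2 (i + k.+1)%N i - E2 (i + k)%N i))).
    rewrite mulr_sumr; apply: eq_bigr => k _; rewrite mulr_sumr.
    apply: eq_bigr => i _; rewrite /E1 /E2 !addnS !addSn; ring.
  under eq_bigr do rewrite sumrB big_split /=.
  rewrite sumrB big_split /=; congr (_ + _ - _).
  - rewrite exchange_big_nat /=; apply: eq_bigr => i _.
    rewrite sumrN (telescope_sumr (fun k => E1 (i + k)%N i.+1)) // addn0.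
    by rewrite opprB.
  - apply: eq_bigr => k _.
    by rewrite (telescope_sumr (fun i => E1 (i + k)%N i)).
  - rewrite exchange_big_nat /=; apply: eq_bigr => i _.
    by rewrite (telescope_sumr (fun k => E2 (i + k)%N i)) // addn0.
have sum_le n (G H : nat -> R) :
    (forall i, (i < n)%N -> `|G i| <= e) -> (forall i, (i < n)%N -> `|H i| <= e) ->
    `|\sum_(0 <= i < n) (G i - H i)| <= (2 * n)%N%:R * e.
  move=> Ge He; apply: le_trans (ler_norm_sum _ _ _) _.
  rewrite big_mkord.
  apply: (@le_trans _ _ (\sum_(i < n) (e + e))).
    apply: ler_sum => i _; apply: le_trans (ler_normB _ _) _.
    by apply: lerD; [exact: Ge | exact: He].
  rewrite sumr_const card_ord -[leLHS]mulr_natl natrM.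
  by rewrite le_eqVlt; apply/orP; left; apply/eqP; ring.
have h1 := sum_le N (fun i => E1 i i.+1) (fun i => E1 (i + K)%N i.+1).
have h2 := sum_le K (fun k => E1 (N + k)%N N) (fun k => E1 k 0%N).
have h3 := sum_le N (fun i => E2 (i + K)%N i) (fun i => E2 i i).
apply: le_trans (ler_normB _ _) _.
apply: le_trans (lerD (ler_normD _ _) (lexx _)) _.
have -> : (4 * N + 2 * K)%N%:R * e
    = (2 * N)%N%:R * e + (2 * K)%N%:R * e + (2 * N)%N%:R * e :> R.
  by rewrite [in LHS]natrD !natrM; ring.
apply: lerD; first apply: lerD.
- apply: h1 => i iN; apply: E1e; lia.
- apply: h2 => i iN; apply: E1e; lia.
- apply: h3 => i iN; apply: E2e; lia.
Qed.

Section PairNorm.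
Context {R : realType} {m n : nat}.
Implicit Types (p : 'rV[R]_m) (q : 'rV[R]_n).

(** Pairs are encoded as concatenated rows, so that the triangle inequality in the product space is
    [enormD]. *)
Lemma sqr_enorm_row_mx p q :
  enorm (row_mx p q) ^+ 2 = enorm p ^+ 2 + enorm q ^+ 2.
Proof.
rewrite !sqr_enorm /dotp big_split_ord /=; congr (_ + _).
  by apply: eq_bigr => i _; rewrite row_mxEl.
by apply: eq_bigr => i _; rewrite row_mxEr.
Qed.

Lemma enorm_row_mx_le p q : enorm (row_mx p q) <= enorm p + enorm q.
Proof.
rewrite -(ler_pXn2r (n := 2)) ?nnegrE ?addr_ge0 ?enorm_ge0 //.
rewrite sqr_enorm_row_mx sqrrD lerD2r lerDl.
by rewrite mulrn_wge0 // mulr_ge0 ?enorm_ge0.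
Qed.

End PairNorm.

Lemma enorm_sum_nat_le (R : realType) (n N : nat) (F : nat -> 'rV[R]_n) (c : R) :
  (forall i, (i < N)%N -> enorm (F i) <= c) ->
  enorm (\sum_(0 <= i < N) F i) <= N%:R * c.
Proof.
move=> Fc; apply: le_trans (enorm_sum _ _) _; rewrite big_mkord.
apply: (@le_trans _ _ (\sum_(i < N) c)); first by apply: ler_sum => i _; apply: Fc.
by rewrite sumr_const card_ord -[leLHS]mulr_natl.
Qed.

Lemma sqrt_addr_le (R : realType) (a b : R) : 0 <= a -> 0 <= b ->
  Num.sqrt (a + b) <= Num.sqrt a + Num.sqrt b.
Proof.
move=> a0 b0.
rewrite -(ler_pXn2r (n := 2)) ?nnegrE ?addr_ge0 ?sqrtr_ge0 //.
rewrite sqrrD !sqr_sqrtr ?addr_ge0 // addrAC lerDl.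
by rewrite mulrn_wge0 // mulr_ge0 ?sqrtr_ge0.
Qed.

(** * The Lipschitz bound for the exact descent-ascent map *)

Section Contraction.
Context {R : realType} {m n : nat}.
Variables (X : set 'rV[R]_m) (Y : set 'rV[R]_n).
Variables (f : 'rV[R]_m * 'rV[R]_n -> R).
Variables (gx : 'rV[R]_m * 'rV[R]_n -> 'rV[R]_m).
Variables (gy : 'rV[R]_m * 'rV[R]_n -> 'rV[R]_n).
Variables (mu L Lc alpha : R).
Hypothesis L_ge0 : 0 <= L.
Hypothesis mu_le_L : mu <= L.
Hypothesis Lc_ge0 : 0 <= Lc.
Hypothesis alpha_ge0 : 0 <= alpha.
Hypothesis fx_quad : forall x x' y, X x -> X x' -> Y y ->
  `|f (x', y) - f (x, y) - dotp (gx (x, y)) (x' - x)|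
  <= L / 2 * enorm (x' - x) ^+ 2.
Hypothesis fy_quad : forall x y y', X x -> Y y -> Y y' ->
  `|f (x, y') - f (x, y) - dotp (gy (x, y)) (y' - y)|
  <= L / 2 * enorm (y' - y) ^+ 2.
Hypothesis gx_coco : forall x x' y, X x -> X x' -> Y y ->
  enorm (gx (x', y) - gx (x, y) - ((L + mu) / 2) *: (x' - x))
  <= (L - mu) / 2 * enorm (x' - x).
Hypothesis gy_coco : forall x y y', X x -> Y y -> Y y' ->
  enorm (gy (x, y) - gy (x, y') - ((L + mu) / 2) *: (y' - y))
  <= (L - mu) / 2 * enorm (y' - y).
Hypothesis gx_cross : forall x y y', X x -> Y y -> Y y' ->
  enorm (gx (x, y') - gx (x, y)) <= Lc * enorm (y' - y).
Hypothesis gy_cross : forall x x' y, X x -> X x' -> Y y ->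
  enorm (gy (x', y) - gy (x, y)) <= Lc * enorm (x' - x).
Hypothesis gx_lip : forall x x' y, X x -> X x' -> Y y ->
  enorm (gx (x', y) - gx (x, y)) <= L * enorm (x' - x).
Hypothesis gy_lip : forall x y y', X x -> Y y -> Y y' ->
  enorm (gy (x, y') - gy (x, y)) <= L * enorm (y' - y).

Local Notation k0 := (1 - alpha * ((L + mu) / 2)).

(** Staircase [k] runs from [(xx k, yy 0)] to [(xx (N + k), yy N)], each x-step followed by a
    y-step. The term divided by [K] is what averaging over the band leaves of the failure of
    skew-symmetry. *)
Lemma staircase_contraction (xx : nat -> 'rV[R]_m) (yy : nat -> 'rV[R]_n)
    (u : 'rV[R]_m) (v : 'rV[R]_n) (N K : nat) (h : R) :
  (0 < K)%N -> 0 < h -> h * (N + K)%:R = 1 ->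
  (forall i, (i <= N + K)%N -> X (xx i)) ->
  (forall i, (i <= N + K)%N -> Y (yy i)) ->
  (forall i, xx i.+1 - xx i = h *: u) ->
  (forall i, yy i.+1 - yy i = h *: v) ->
  let W := enorm u ^+ 2 + enorm v ^+ 2 in
  exists2 k, (k < K)%N &
  enorm (row_mx
    ((h * N%:R) *: u
     - alpha *: (gx (xx (N + k)%N, yy N) - gx (xx k, yy 0%N)))
    ((h * N%:R) *: v
     + alpha *: (gy (xx (N + k)%N, yy N) - gy (xx k, yy 0%N))))
  <= Num.sqrt ((k0 ^+ 2 + alpha ^+ 2 * Lc ^+ 2) * W
               + 4 * alpha * `|k0| * L * W / K%:R)
     + alpha * ((L - mu) / 2) * Num.sqrt W.
Proof.
move=> K0 h0 hM Xx Yy dx dy W.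
have L0 := L_ge0; have muL := mu_le_L; have Lc0 := Lc_ge0; have al0 := alpha_ge0.
have W0 : 0 <= W by rewrite addr_ge0 // sqr_ge0.
have KR : 0 < K%:R :> R by rewrite ltr0n.
pose G i j := gx (xx i, yy j); pose H i j := gy (xx i, yy j).
pose P k := \sum_(0 <= i < N) (G (i + k).+1 i.+1 - G (i + k).+1 i).
pose Q k := \sum_(0 <= i < N) (H (i + k).+1 i - H (i + k)%N i).
pose Sg k := \sum_(0 <= i < N) (G (i + k).+1 i - G (i + k)%N i).
pose Sh k := \sum_(0 <= i < N) (H (i + k).+1 i - H (i + k).+1 i.+1).
have GE k : G (N + k)%N N - G k 0%N = Sg k + P k.
  transitivity (\sum_(0 <= i < N) (G (i.+1 + k)%N i.+1 - G (i + k)%N i)).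
    by rewrite (telescope_sumr (fun i => G (i + k)%N i)).
  rewrite -big_split /=.
  by apply: eq_bigr => i _; rewrite addrC addrA subrK.
have HE k : H (N + k)%N N - H k 0%N = Q k - Sh k.
  transitivity (\sum_(0 <= i < N) (H (i.+1 + k)%N i.+1 - H (i + k)%N i)).
    by rewrite (telescope_sumr (fun i => H (i + k)%N i)).
  rewrite -sumrB.
  by apply: eq_bigr => i _; rewrite addSn opprB [RHS]addrC addrA subrK.
have exx i : enorm (xx i.+1 - xx i) = h * enorm u.
  by rewrite dx enormZ gtr0_norm.
have eyy i : enorm (yy i.+1 - yy i) = h * enorm v.
  by rewrite dy enormZ gtr0_norm.
set kp := h * N%:R.
have kp0 : 0 <= kp by rewrite mulr_ge0 // ltW.
have kp1 : kp <= 1 by rewrite -[leRHS]hM ler_pM2l // ler_nat leq_addr.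
have Pb k : (k < K)%N -> enorm (P k) <= kp * (Lc * enorm v).
  move=> kK; have -> : kp * (Lc * enorm v) = N%:R * (Lc * (h * enorm v)).
    by rewrite /kp; ring.
  apply: enorm_sum_nat_le => i iN; rewrite -(eyy i) /G.
  by apply: gx_cross; [apply: Xx | apply: Yy | apply: Yy]; clear -iN kK; lia.
have Qb k : (k < K)%N -> enorm (Q k) <= kp * (Lc * enorm u).
  move=> kK; have -> : kp * (Lc * enorm u) = N%:R * (Lc * (h * enorm u)).
    by rewrite /kp; ring.
  apply: enorm_sum_nat_le => i iN; rewrite -(exx (i + k)%N) /H.
  by apply: gy_cross; [apply: Xx | apply: Xx | apply: Yy]; clear -iN kK; lia.
have Sgb k : (k < K)%N ->
    enorm (Sg k - (kp * ((L + mu) / 2)) *: u) <= kp * ((L - mu) / 2 * enorm u).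
  move=> kK.
  have -> : Sg k - (kp * ((L + mu) / 2)) *: u = \sum_(0 <= i < N)
      (G (i + k).+1 i - G (i + k)%N i - ((L + mu) / 2) *: (h *: u)).
    rewrite sumrB; congr (_ - _); rewrite big_mkord sumr_const card_ord.
    by rewrite -[RHS]scaler_nat !scalerA /kp; apply/rowP => j; rewrite !mxE; ring.
  have -> : kp * (((L - mu) / 2) * enorm u) = N%:R * (((L - mu) / 2) * (h * enorm u)).
    by rewrite /kp; ring.
  apply: enorm_sum_nat_le => i iN; rewrite -(exx (i + k)%N) -(dx (i + k)%N) /G.
  by apply: gx_coco; [apply: Xx | apply: Xx | apply: Yy]; clear -iN kK; lia.
have Shb k : (k < K)%N ->
    enorm (Sh k - (kp * ((L + mu) / 2)) *: v) <= kp * ((L - mu) / 2 * enorm v).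
  move=> kK.
  have -> : Sh k - (kp * ((L + mu) / 2)) *: v = \sum_(0 <= i < N)
      (H (i + k).+1 i - H (i + k).+1 i.+1 - ((L + mu) / 2) *: (h *: v)).
    rewrite sumrB; congr (_ - _); rewrite big_mkord sumr_const card_ord.
    by rewrite -[RHS]scaler_nat !scalerA /kp; apply/rowP => j; rewrite !mxE; ring.
  have -> : kp * (((L - mu) / 2) * enorm v) = N%:R * (((L - mu) / 2) * (h * enorm v)).
    by rewrite /kp; ring.
  apply: enorm_sum_nat_le => i iN; rewrite -(eyy i) -(dy i) /H.
  by apply: gy_coco; [apply: Xx | apply: Yy | apply: Yy]; clear -iN kK; lia.
(* The skewness defect of staircase [k]: it would vanish if the cross increments came from a
   constant Hessian. *)
pose D k := dotp u (P k) - dotp v (Q k).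
have Db : `|\sum_(0 <= k < K) D k| <= 2 * L * W.
  pose e := L / 2 * (h ^+ 2 * W).
  have e0 : 0 <= e by rewrite !mulr_ge0 // ?sqr_ge0 // ltW.
  have := @staircase_sum R (fun i j => dotp u (G i j)) (fun i j => dotp v (H i j))
    (fun i j => f (xx i, yy j)) h e N K.
  have -> : \sum_(0 <= k < K) D k = \sum_(0 <= k < K) \sum_(0 <= i < N)
      (dotp u (G (i + k).+1 i.+1) - dotp u (G (i + k).+1 i)
       - (dotp v (H (i + k).+1 i) - dotp v (H (i + k)%N i))).
    apply: eq_bigr => k _; rewrite /D /P /Q !dotp_sumr -sumrB.
    by apply: eq_bigr => i _; rewrite !dotpDr !dotpNr.
  move=> S; rewrite -(ler_pM2l h0) -[X in X * `|_|](gtr0_norm h0) -normrM.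
  apply: le_trans (S _ _) _ => [i j iM jM|i j iM jM|].
  - have xi : X (xx i) by apply: Xx; exact: ltnW.
    have xi1 : X (xx i.+1) by exact: Xx.
    have := fx_quad xi1 xi (Yy _ jM).
    rewrite -(opprB (xx i.+1)) enormN exx dx dotpNr dotpZr (dotpC _ u) -/(G _ _).
    rewrite -[X in X <= _]normrN => q.
    apply: le_trans (_ : L / 2 * (h * enorm u) ^+ 2 <= e); last first.
      rewrite /e exprMn ler_wpM2l ?divr_ge0 // ler_wpM2l ?sqr_ge0 //.
      by rewrite /W lerDl sqr_ge0.
    by move: q; congr (`|_| <= _); ring.
  - have yj : Y (yy j) by apply: Yy; exact: ltnW.
    have yj1 : Y (yy j.+1) by exact: Yy.
    have := fy_quad (Xx _ iM) yj yj1.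
    rewrite eyy dy dotpZr (dotpC _ v) -/(H _ _) => q.
    apply: le_trans q _.
    rewrite /e exprMn ler_wpM2l ?divr_ge0 // ler_wpM2l ?sqr_ge0 //.
    by rewrite /W lerDr sqr_ge0.
  (* There are at most [4 (N + K)] errors of size [L / 2 h^2 W]; since [h (N + K) = 1], their sum is
     [h * (2 L W)], and the factor [h] is the one multiplied in above. *)
  - apply: (@le_trans _ _ ((4 * (N + K))%N%:R * e)).
      by rewrite ler_wpM2r // ler_nat; clear; lia.
    rewrite natrM /e.
    have -> : 4 * (N + K)%:R * (L / 2 * (h ^+ 2 * W))
      = (h * (N + K)%:R) * (h * (2 * L * W)) by field.
    by rewrite hM mul1r.
(* Only the sign of [k0 * D k] matters below, so averaging over [k] suffices. *)
have [k kK Dk] : exists2 k, (k < K)%N & - (`|k0| * (2 * L * W) / K%:R) <= k0 * D k.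
  apply: contrapT => Hn.
  have lt k : (k < K)%N -> k0 * D k < - (`|k0| * (2 * L * W) / K%:R).
    by move=> kK; rewrite ltNge; apply/negP => ?; apply: Hn; exists k.
  have : \sum_(0 <= k < K) k0 * D k < - (`|k0| * (2 * L * W)).
    have -> : - (`|k0| * (2 * L * W))
        = \sum_(0 <= k < K) - (`|k0| * (2 * L * W) / K%:R) :> R.
      rewrite big_mkord sumr_const card_ord -[RHS]mulr_natl.
      by field; rewrite gt_eqF.
    rewrite !big_mkord; apply: ltr_sum => [|k _]; last exact: lt.
    by apply/hasP; exists (Ordinal K0); rewrite ?mem_index_enum.
  rewrite -mulr_sumr ltNge => /negP; apply.
  rewrite lerNl; apply: le_trans (ler_norm _) _.
  by rewrite normrN normrM ler_wpM2l.
exists k => //; rewrite -/(G _ _) -/(G _ _) -/(H _ _) -/(H _ _) GE HE.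
have {}Pb := Pb k kK; have {}Qb := Qb k kK.
have {}Sgb := Sgb k kK; have {}Shb := Shb k kK.
rewrite /D in Dk.
move: (P k) (Q k) (Sg k) (Sh k) Dk Pb Qb Sgb Shb => p q sg sh Dk Pb Qb Sgb Shb.
set ab := (L + mu) / 2 in Dk Sgb Shb *.
(* Same-variable increments are replaced by their middle slope [ab], the remainder being controlled
   by cocoercivity. The first vector has squared norm [(k0 kp)^2 W + alpha^2 (|p|^2 + |q|^2) - 2
   alpha k0 kp (<u, p> - <v, q>)], whose last term is controlled by [Dk]. *)
have -> : row_mx (kp *: u - alpha *: (sg + p)) (kp *: v + alpha *: (q - sh))
  = row_mx ((k0 * kp) *: u - alpha *: p) ((k0 * kp) *: v + alpha *: q)
    - alpha *: row_mx (sg - (kp * ab) *: u) (sh - (kp * ab) *: v).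
  rewrite scale_row_mx opp_row_mx add_row_mx -/ab.
  by congr row_mx; apply/rowP => i; rewrite !mxE; ring.
apply: le_trans (enormD _ _) _; apply: lerD; last first.
  rewrite enormN enormZ (ger0_norm al0) -mulrA ler_wpM2l //.
  have lm0 : 0 <= (L - mu) / 2 by lra.
  rewrite -(ler_pXn2r (n := 2)) ?nnegrE ?enorm_ge0
    ?(mulr_ge0 lm0 (sqrtr_ge0 _)) //.
  rewrite sqr_enorm_row_mx [leRHS]exprMn [in leRHS]sqr_sqrtr // /W [leRHS]mulrDr.
  have sq (a b : R) : 0 <= a -> 0 <= b -> a <= kp * ((L - mu) / 2 * b) ->
      a ^+ 2 <= ((L - mu) / 2) ^+ 2 * b ^+ 2.
    move=> a0 b0 ab'; have lb := mulr_ge0 lm0 b0.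
    rewrite -exprMn ler_pXn2r ?nnegrE //.
    by apply: le_trans ab' _; rewrite ler_piMl.
  by apply: lerD; apply: sq; rewrite ?enorm_ge0.
rewrite -/ab -(ler_pXn2r (n := 2)) ?nnegrE ?enorm_ge0 ?sqrtr_ge0 //.
rewrite [in leRHS]sqr_sqrtr; last first.
  by rewrite addr_ge0 // ?mulr_ge0 ?addr_ge0 ?sqr_ge0 ?invr_ge0 ?normr_ge0
    ?mulr_ge0 ?sqr_ge0.
rewrite sqr_enorm_row_mx !sqr_enorm !dotpE (dotpC p u) (dotpC q v).
have sq (a b : R) : 0 <= a -> 0 <= b -> a <= kp * (Lc * b) ->
    a ^+ 2 <= Lc ^+ 2 * b ^+ 2.
  move=> a0 b0 ab'; rewrite -exprMn ler_pXn2r ?nnegrE ?mulr_ge0 //.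
  by apply: le_trans ab' _; rewrite ler_piMl // mulr_ge0.
have p2 := sq _ _ (enorm_ge0 p) (enorm_ge0 v) Pb.
have q2 := sq _ _ (enorm_ge0 q) (enorm_ge0 u) Qb.
have a1 : alpha ^+ 2 * (enorm p ^+ 2 + enorm q ^+ 2) <= alpha ^+ 2 * (Lc ^+ 2 * W).
  by rewrite ler_wpM2l ?sqr_ge0 // /W mulrDr addrC lerD.
have a2 : (1 - alpha * ab) ^+ 2 * (kp ^+ 2 * W) <= (1 - alpha * ab) ^+ 2 * W.
  by rewrite ler_wpM2l ?sqr_ge0 // ler_piMl // expr_le1.
set B := `|1 - alpha * ab| * (2 * L * W) / K%:R in Dk.
have B0 : 0 <= B by rewrite !mulr_ge0 ?invr_ge0 // ltW.
have a3 : 2 * alpha * kp * (- ((1 - alpha * ab) * (dotp u p - dotp v q)))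
    <= 2 * alpha * B.
  rewrite -mulrA ler_wpM2l ?mulr_ge0 //.
  apply: (@le_trans _ _ (kp * B)); last by rewrite ler_piMl.
  by rewrite ler_wpM2l //; lra.
have -> : 4 * alpha * `|1 - alpha * ab| * L * W / K%:R = 2 * alpha * B.
  by rewrite /B; field; rewrite gt_eqF.
move: a1 a2; rewrite /W !sqr_enorm; lra.
Qed.

Let gx_cont x x' y y' : X x -> X x' -> Y y -> Y y' ->
  enorm (gx (x', y') - gx (x, y))
  <= (L + Lc) * (enorm (x' - x) + enorm (y' - y)).
Proof.
move=> Xx Xx' Yy Yy'.
have -> : gx (x', y') - gx (x, y)
    = (gx (x', y') - gx (x, y')) + (gx (x, y') - gx (x, y)).
  by rewrite addrA subrK.
apply: le_trans (enormD _ _) _.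
apply: le_trans (lerD (gx_lip Xx Xx' Yy') (gx_cross Xx Yy Yy')) _.
by rewrite mulrDr lerD // ler_wpM2r ?enorm_ge0 // ?lerDl ?lerDr.
Qed.

Let gy_cont x x' y y' : X x -> X x' -> Y y -> Y y' ->
  enorm (gy (x', y') - gy (x, y))
  <= (L + Lc) * (enorm (x' - x) + enorm (y' - y)).
Proof.
move=> Xx Xx' Yy Yy'.
have -> : gy (x', y') - gy (x, y)
    = (gy (x', y') - gy (x, y')) + (gy (x, y') - gy (x, y)).
  by rewrite addrA subrK.
apply: le_trans (enormD _ _) _.
apply: le_trans (lerD (gy_cross Xx Xx' Yy') (gy_lip Xx Yy Yy')) _.
by rewrite mulrDr lerD // ler_wpM2r ?enorm_ge0 // ?lerDl ?lerDr.
Qed.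

Hypothesis X_convex : convex_set X.
Hypothesis Y_convex : convex_set Y.

(** The segment is cut into [N + K] equal pieces. Every staircase of the band ends within [K] pieces
    of the true endpoints, so the mismatch is negligible by Lipschitz continuity of the
    gradients. *)
Lemma descent_ascent_contraction x0 x1 y0 y1 :
  X x0 -> X x1 -> Y y0 -> Y y1 ->
  enorm (row_mx (x1 - x0 - alpha *: (gx (x1, y1) - gx (x0, y0)))
                (y1 - y0 + alpha *: (gy (x1, y1) - gy (x0, y0))))
  <= (Num.sqrt (k0 ^+ 2 + alpha ^+ 2 * Lc ^+ 2) + alpha * ((L - mu) / 2))
     * Num.sqrt (enorm (x1 - x0) ^+ 2 + enorm (y1 - y0) ^+ 2).
Proof.
move=> Xx0 Xx1 Yy0 Yy1.
have [u uE] : exists u, u = x1 - x0 by exists (x1 - x0).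
have [v vE] : exists v, v = y1 - y0 by exists (y1 - y0).
rewrite -uE -vE.
have L0 := L_ge0; have Lc0 := Lc_ge0; have al0 := alpha_ge0.
set W := enorm u ^+ 2 + enorm v ^+ 2; have W0 : 0 <= W by rewrite addr_ge0 // sqr_ge0.
set s2 := k0 ^+ 2 + alpha ^+ 2 * Lc ^+ 2.
have s20 : 0 <= s2 by rewrite addr_ge0 ?sqr_ge0 // mulr_ge0 ?sqr_ge0.
set w := enorm u + enorm v; have w0 : 0 <= w by rewrite addr_ge0 ?enorm_ge0.
set C4 := 4 * alpha * `|k0| * L * W; have C40 : 0 <= C4 by rewrite !mulr_ge0.
(* Collects the endpoint mismatch: the missing part of [(u, v)], and four gradient differences of
   size at most [(L + Lc) e w]. *)
set C3 := w * (1 + 4 * (alpha * (L + Lc))).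
have aL0 : 0 <= alpha * (L + Lc) by rewrite mulr_ge0 // addr_ge0.
have C30 : 0 <= C3 by rewrite mulr_ge0 // addr_ge0 // mulr_ge0.
apply: (@ler_addgt0_scaled R _ _ (Num.sqrt C4 + C3)).
  by rewrite addr_ge0 // sqrtr_ge0.
move=> e /andP[e0 e1].
(* [K > e ^- 2] turns the averaged error [sqrt (C4 / K)] into at most [e * sqrt C4]. *)
pose K := (Num.trunc (e ^- 2)).+1.
have K0 : (0 < K)%N by [].
have KR : 0 < K%:R :> R by rewrite ltr0n.
have Ke2 : K%:R^-1 <= e ^+ 2 :> R.
  rewrite -[leRHS]invrK lef_pV2 ?posrE ?invr_gt0 ?exprn_gt0 //.
  by rewrite ltW // truncnS_gt.
have Ke : K%:R^-1 <= e :> R.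
  by apply: le_trans Ke2 _; rewrite expr2 ler_piMl // ltW.
(* [N = K^2]: the band is wide, [1 / K -> 0], yet thin, [K / N -> 0]. *)
pose N := (K * K)%N; pose M := (N + K)%N.
have MR : 0 < M%:R :> R by rewrite ltr0n /M addn_gt0 K0 orbT.
pose h : R := M%:R^-1.
have h0 : 0 < h by rewrite invr_gt0.
have hM : h * (N + K)%:R = 1 by rewrite mulVf ?gt_eqF.
have hK : h * K%:R <= e.
  apply: le_trans Ke; rewrite /h ler_pdivrMl // ler_pdivlMr //.
  by rewrite -natrM ler_nat /M /N leq_addr.
pose xx i := x0 + (h * i%:R) *: u; pose yy i := y0 + (h * i%:R) *: v.
have hi i : (i <= N + K)%N -> 0 <= h * i%:R <= 1.
  move=> iM; apply/andP; split; first by rewrite mulr_ge0 // ltW.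
  by rewrite -[leRHS]hM ler_pM2l // ler_nat.
have Xxx i : (i <= N + K)%N -> X (xx i).
  by move=> /hi iM; rewrite /xx uE; exact: convex_setE.
have Yyy i : (i <= N + K)%N -> Y (yy i).
  by move=> /hi iM; rewrite /yy vE; exact: convex_setE.
have dx i : xx i.+1 - xx i = h *: u.
  by rewrite /xx mulrSr; apply/rowP => j; rewrite !mxE; ring.
have dy i : yy i.+1 - yy i = h *: v.
  by rewrite /yy mulrSr; apply/rowP => j; rewrite !mxE; ring.
have [k kK] := staircase_contraction K0 h0 hM Xxx Yyy dx dy.
rewrite -/W -/s2 -/C4 => Hk.
have x1E : x1 = xx M by rewrite /xx hM scale1r uE addrC subrK.
have y1E : y1 = yy M by rewrite /yy hM scale1r vE addrC subrK.
have x0E : x0 = xx 0%N by rewrite /xx mulr0 scale0r addr0.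
have y0E : y0 = yy 0%N by rewrite /yy mulr0 scale0r addr0.
have xd i j : (j <= i)%N -> (i - j <= K)%N -> enorm (xx i - xx j) <= e * enorm u.
  move=> ji ijK; have -> : xx i - xx j = (h * (i - j)%:R) *: u.
    by rewrite /xx natrB //; apply/rowP => l; rewrite !mxE; ring.
  rewrite enormZ ger0_norm ?mulr_ge0 ?(ltW h0) // ler_wpM2r ?enorm_ge0 //.
  by apply: le_trans hK; rewrite ler_pM2l // ler_nat.
have yd i j : (j <= i)%N -> (i - j <= K)%N -> enorm (yy i - yy j) <= e * enorm v.
  move=> ji ijK; have -> : yy i - yy j = (h * (i - j)%:R) *: v.
    by rewrite /yy natrB //; apply/rowP => l; rewrite !mxE; ring.
  rewrite enormZ ger0_norm ?mulr_ge0 ?(ltW h0) // ler_wpM2r ?enorm_ge0 //.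
  by apply: le_trans hK; rewrite ler_pM2l // ler_nat.
have NkM : (N + k <= N + K)%N by rewrite leq_add2l ltnW.
have kM : (k <= N + K)%N by rewrite (leq_trans (ltnW kK)) // leq_addl.
have XNk : X (xx (N + k)%N) by exact: Xxx.
have XM : X (xx M) by apply: Xxx.
have Xk : X (xx k) by exact: Xxx.
have YM : Y (yy M) by apply: Yyy.
have YN : Y (yy N) by apply: Yyy; exact: leq_addr.
have X0 : X (xx 0%N) by apply: Xxx.
have Y0 : Y (yy 0%N) by apply: Yyy.
have dxM : enorm (xx M - xx (N + k)%N) <= e * enorm u.
  by apply: xd; rewrite /M //; clear -kK; lia.
have dyM : enorm (yy M - yy N) <= e * enorm v by apply: yd; rewrite /M ?leq_addr // addKn.
have dx0 : enorm (xx k - xx 0%N) <= e * enorm u.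
  by apply: xd; rewrite ?subn0 // ltnW.
have dy0 : enorm (yy 0%N - yy 0%N) <= e * enorm v by apply: yd; rewrite ?subnn.
have LLc : 0 <= L + Lc by rewrite addr_ge0.
have ew (a b : R) : a <= e * enorm u -> b <= e * enorm v ->
    (L + Lc) * (a + b) <= (L + Lc) * (e * w).
  by move=> ha hb; rewrite ler_wpM2l // /w mulrDr lerD.
have gx1 := le_trans (gx_cont XNk XM YN YM) (ew _ _ dxM dyM).
have gy1 := le_trans (gy_cont XNk XM YN YM) (ew _ _ dxM dyM).
have gx0 := le_trans (gx_cont X0 Xk Y0 Y0) (ew _ _ dx0 dy0).
have gy0 := le_trans (gy_cont X0 Xk Y0 Y0) (ew _ _ dx0 dy0).
set V := row_mx _ _ in Hk.
(* The staircase accounts for the fraction [h N] of [(u, v)]; the remaining fraction [h K] and the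
   gradient changes at both ends form the second vector. *)
have -> : row_mx (u - alpha *: (gx (x1, y1) - gx (x0, y0)))
                 (v + alpha *: (gy (x1, y1) - gy (x0, y0)))
  = V + row_mx ((h * K%:R) *: u
     - alpha *: ((gx (xx M, yy M) - gx (xx (N + k)%N, yy N))
                 + (gx (xx k, yy 0%N) - gx (xx 0%N, yy 0%N))))
    ((h * K%:R) *: v
     + alpha *: ((gy (xx M, yy M) - gy (xx (N + k)%N, yy N))
                 + (gy (xx k, yy 0%N) - gy (xx 0%N, yy 0%N)))).
  rewrite /V add_row_mx -x1E -y1E -x0E -y0E.
  have -> : h * K%:R = 1 - h * N%:R by move: hM; rewrite natrD; lra.
  by congr row_mx; apply/rowP => j; rewrite !mxE; ring.
apply: le_trans (enormD _ _) _.
apply: le_trans (lerD Hk (enorm_row_mx_le _ _)) _.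
have part p (z a b : 'rV[R]_p) : enorm a <= (L + Lc) * (e * w) ->
    enorm b <= (L + Lc) * (e * w) ->
    enorm ((h * K%:R) *: z + alpha *: (a + b))
    <= e * enorm z + 2 * (alpha * ((L + Lc) * (e * w))).
  move=> ha hb; apply: le_trans (enormD _ _) _; rewrite !enormZ.
  rewrite (ger0_norm al0) ger0_norm ?mulr_ge0 ?(ltW h0) //.
  apply: lerD; first by rewrite ler_wpM2r ?enorm_ge0.
  rewrite mulrCA ler_wpM2l //; apply: le_trans (enormD _ _) _.
  by rewrite mulr_natl mulr2n lerD.
have partN p (z a b : 'rV[R]_p) : enorm a <= (L + Lc) * (e * w) ->
    enorm b <= (L + Lc) * (e * w) ->
    enorm ((h * K%:R) *: z - alpha *: (a + b))
    <= e * enorm z + 2 * (alpha * ((L + Lc) * (e * w))).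
  by move=> ha hb; rewrite -scalerN opprD; apply: part; rewrite enormN.
apply: le_trans (lerD (lexx _) (lerD (partN _ u _ _ gx1 gx0) (part _ v _ _ gy1 gy0))) _.
have hs : Num.sqrt (s2 * W + C4 / K%:R)
    <= Num.sqrt s2 * Num.sqrt W + Num.sqrt C4 * e.
  apply: le_trans (sqrt_addr_le _ _) _; rewrite ?mulr_ge0 ?invr_ge0 //.
  rewrite sqrtrM // lerD2l.
  apply: (@le_trans _ _ (Num.sqrt (C4 * e ^+ 2))).
    by apply: ler_wsqrtr; rewrite ler_wpM2l.
  by rewrite sqrtrM // sqrtr_sqr ger0_norm // ltW.
apply: le_trans (lerD (lerD hs (lexx _)) (lexx _)) _.
by rewrite /C3 /w le_eqVlt; apply/orP; left; apply/eqP; ring.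
Qed.

End Contraction.

(** * Projections, finite differences and recurrences *)

Section ContractionFactor.
Context {R : realType}.
Variables (mu L Lc alpha : R).

Lemma contraction_factorE :
  contraction_factor mu L Lc alpha
  = (Num.sqrt ((1 - alpha * ((L + mu) / 2)) ^+ 2 + alpha ^+ 2 * Lc ^+ 2)
     + alpha * ((L - mu) / 2)) ^+ 2.
Proof.
rewrite /contraction_factor.
set s := (1 - _) ^+ 2 + _.
have s0 : 0 <= s by rewrite addr_ge0 ?sqr_ge0 // mulr_ge0 ?sqr_ge0.
have -> : (L * alpha + mu * alpha - 2) ^+ 2 + 4 * Lc ^+ 2 * alpha ^+ 2
    = 2 ^+ 2 * s by rewrite /s; field.
rewrite sqrtrM ?sqr_ge0 // sqrtr_sqr ger0_norm //.
by rewrite sqrrD sqr_sqrtr // /s; field.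
Qed.

Lemma contraction_factor_ge0 : 0 <= contraction_factor mu L Lc alpha.
Proof. by rewrite contraction_factorE sqr_ge0. Qed.

(** By the closed form, beta < 1 amounts to [q < (1 - alpha (L - mu) / 2)^2]. The difference of the
    two sides is [alpha (2 mu - alpha (mu L + Lc^2))], positive exactly in the admissible range of
    step sizes. *)
Lemma contraction_factor_lt1 : 0 < mu -> mu <= L -> 0 < alpha ->
  alpha < 2 * mu / (mu * L + Lc ^+ 2) ->
  contraction_factor mu L Lc alpha < 1.
Proof.
move=> mu0 muL al0; have L0 : 0 < L by exact: lt_le_trans muL.
have d0 : 0 < mu * L + Lc ^+ 2 by rewrite ltr_wpDr ?sqr_ge0 ?mulr_gt0.
rewrite ltr_pdivlMr // mulrDr => al.
(* Makes [1 - alpha (L - mu) / 2] nonnegative, so that comparing squares is legitimate. *)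
have aL : alpha * L < 2.
  rewrite -(ltr_pM2r mu0); apply: le_lt_trans al.
  have := mulr_ge0 (ltW al0) (sqr_ge0 Lc); lra.
have am : 0 < alpha * mu by rewrite mulr_gt0.
have aLm : 0 <= alpha * (L - mu) by rewrite mulr_ge0 ?subr_ge0 // ltW.
rewrite contraction_factorE; set q := (1 - _) ^+ 2 + _.
have q0 : 0 <= q by rewrite addr_ge0 ?sqr_ge0 // mulr_ge0 ?sqr_ge0.
set s := Num.sqrt _.
have s0 : 0 <= s by exact: sqrtr_ge0.
suff : s + alpha * ((L - mu) / 2) < 1.
  by move=> h; rewrite expr_lt1 // addr_ge0 //; lra.
rewrite -ltrBrDr -(ltr_pXn2r (n := 2)) ?nnegrE //; last by lra.
rewrite sqr_sqrtr // -subr_gt0.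
have -> : (1 - alpha * ((L - mu) / 2)) ^+ 2 - q
  = alpha * (2 * mu - (alpha * (mu * L) + alpha * Lc ^+ 2)) by rewrite /q; field.
by rewrite mulr_gt0 // subr_gt0.
Qed.

End ContractionFactor.

Section Projection.
Context {R : realType} {n : nat}.
Implicit Types (A : set 'rV[R]_n) (a p z : 'rV[R]_n).

(** Minimality of [p] against [p + t (a - p)], divided by [t], with [t] tending to 0. *)
Lemma is_proj_dotp_le0 A z p a : convex_set A -> is_proj A z p -> A a ->
  dotp (z - p) (a - p) <= 0.
Proof.
move=> cA [Ap pmin] Aa.
apply: (@ler_addgt0_scaled R _ _ (enorm (a - p) ^+ 2 / 2)).
  by rewrite divr_ge0 ?sqr_ge0.
move=> t /andP[t0 t1].
have := pmin _ (convex_setE cA Ap Aa (s := t) _).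
rewrite (ltW t0) t1 => /(_ isT).
rewrite -(ler_pXn2r (n := 2)) ?nnegrE ?enorm_ge0 // !sqr_enorm.
have -> : p + t *: (a - p) - z = t *: (a - p) - (z - p).
  by apply/rowP => i; rewrite !mxE; ring.
rewrite -(opprB z p); move: (a - p) (z - p) => u w.
rewrite !dotpE !opprK (dotpC u w) => h.
rewrite -(ler_pM2l t0); lra.
Qed.

(* Only the distance of [a] to the projected point is needed in the error term,
   and this distance is at most the diameter, unlike that of [a] to [w]. *)
Lemma is_proj_dist A w e p a D eta : convex_set A -> is_proj A (w + e) p ->
  A a -> enorm e <= eta -> enorm (p - a) <= D ->
  enorm (p - a) ^+ 2 <= enorm (w - a) ^+ 2 + 2 * D * eta.
Proof.
move=> cA pA Aa e_eta pD; have h := is_proj_dotp_le0 cA pA Aa.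
have eD : dotp e (p - a) <= eta * D.
  apply: le_trans (dotp_le_enorm _ _) _.
  by apply: ler_pM; rewrite ?enorm_ge0.
have h2 := dotp_ge0 ((w - a) - (p - a)).
move: h; have -> : w + e - p = (w - a) + e - (p - a).
  by apply/rowP => i; rewrite !mxE; ring.
rewrite -(opprB p a) !sqr_enorm; move: h2 eD; move: (w - a) (p - a) => u v.
rewrite !dotpE !opprK (dotpC v u); lra.
Qed.

Lemma expand_delta A a (k : 'I_n) (s d : R) : A a -> 0 < d -> `|s| <= d ->
  expand A d (a + s *: delta_mx ord0 k).
Proof.
move=> Aa d0 sd; exists a => //; exists ((s / d) *: delta_mx ord0 k).
  rewrite /eball /= enormZ enorm_delta mulr1 normrM normfV (gtr0_norm d0).
  by rewrite ler_pdivrMr // mul1r.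
by rewrite scalerA mulrCA mulfV ?gt_eqF // mulr1.
Qed.

Lemma sub_expand A d : A `<=` expand A d.
Proof.
move=> a Aa; exists a => //; exists 0; last by rewrite scaler0 addr0.
by rewrite /eball /= enorm0.
Qed.

(** The quadratic bounds at [a + delta e_k] and [a - delta e_k] cancel [phi a] and leave an error at
    most [L delta] per coordinate, hence at most [n L delta <= c] in norm. *)
Lemma central_difference_error A (phi : 'rV[R]_n -> R)
    (g : 'rV[R]_n -> 'rV[R]_n) (L dbar c delta : R) a :
  (0 < n)%N -> 0 < L -> 0 < delta -> delta <= dbar -> delta <= c / (n%:R * L) ->
  gradient_on (expand A dbar) phi g ->
  (forall x y, expand A dbar x -> expand A dbar y ->
     enorm (g x - g y) <= L * enorm (x - y)) ->
  A a ->
  enorm (\row_k ((phi (a + delta *: delta_mx ord0 k)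
                  - phi (a - delta *: delta_mx ord0 k)) / (2 * delta)) - g a)
  <= c.
Proof.
move=> n0 L0 d0 ddb dc phi_g g_lip Aa.
have nR : 0 < n%:R :> R by rewrite ltr0n.
have side s k : `|s| = delta ->
    `|phi (a + s *: delta_mx ord0 k) - phi a - s * g a ord0 k|
    <= L / 2 * delta ^+ 2.
  move=> sd; have := @gradient_quadratic _ _ (expand A dbar) phi g L a
    (a + s *: delta_mx ord0 k) phi_g g_lip.
  rewrite [_ - a]addrC addKr dotpZr dotp_delta enormZ enorm_delta mulr1 sd; apply.
  move=> r /andP[r0 r1]; rewrite scalerA; apply: expand_delta => //.
    exact: lt_le_trans ddb.
  by rewrite normrM sd (ger0_norm r0) (le_trans _ ddb) // ler_piMl // ltW.
apply: (@le_trans _ _ (n%:R * (L * delta))); last first.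
  by rewrite mulrA -ler_pdivlMl ?mulr_gt0 // mulrC.
apply: enorm_le_bound => [|k]; first by rewrite mulr_ge0 // ltW.
rewrite !mxE.
have h1 := side delta k (gtr0_norm d0).
have h2 := side (- delta) k (etrans (normrN _) (gtr0_norm d0)).
rewrite scaleNr in h2.
rewrite -(ler_pM2r (x := 2 * delta)) ?mulr_gt0 //.
rewrite -[X in _ * X <= _](gtr0_norm (_ : 0 < 2 * delta)) ?mulr_gt0 //.
rewrite -normrM mulrBl divfK ?gt_eqF ?mulr_gt0 //.
have -> : forall p q : R, p - q - g a ord0 k * (2 * delta)
    = (p - phi a - delta * g a ord0 k) - (q - phi a - - delta * g a ord0 k).
  by move=> p q; ring.
apply: le_trans (ler_normB _ _) _; apply: le_trans (lerD h1 h2) _.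
have := mulr_ge0 (ltW L0) (sqr_ge0 delta); lra.
Qed.

(** A real [sup] is an upper bound only for a set that is bounded above, which compactness
    provides. *)
Lemma enorm_le_diameter A a a' : compact A -> A a -> A a' ->
  enorm (a - a') <= diameter A.
Proof.
move=> /compact_bounded/pinfty_ex_gt0[M _ AM] Aa Aa'.
apply: ub_le_sup; last by exists a, a'.
exists (n%:R * (M + M)) => _ [b [b' [Ab Ab' ->]]].
apply: le_trans (enorm_le_norm _) _; rewrite ler_wpM2l //.
by apply: le_trans (ler_normB _ _) _; apply: lerD; apply: AM.
Qed.

(** A gradient step of length factor [s <= 1 / (L + 1)] would decrease [phi] by at least
    [s / 2 |g|^2]; the other bound on [s] keeps the step in the ball. *)
Lemma interior_min_gradient0 A (phi : 'rV[R]_n -> R) (g p : 'rV[R]_n) (L r : R) :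
  0 <= L -> 0 < r -> (forall z, enorm (z - p) < r -> A z) ->
  (forall b, A b -> phi b <= phi p + dotp g (b - p) + L / 2 * enorm (b - p) ^+ 2) ->
  (forall b, A b -> phi p <= phi b) -> g = 0.
Proof.
move=> L0 r0 pA up pmin; apply: enorm_eq0; apply/eqP; rewrite -sqrf_eq0 eq_le.
rewrite sqr_ge0 andbT.
have g1 : 0 < enorm g + 1 by rewrite ltr_wpDl ?enorm_ge0.
have L1 : 0 < L + 1 by rewrite ltr_wpDl.
pose s := Num.min (L + 1)^-1 (r / 2 / (enorm g + 1)).
have s0 : 0 < s by rewrite lt_min invr_gt0 L1 !divr_gt0.
have sL : s * (L + 1) <= 1.
  by rewrite -ler_pdivlMr // mul1r ge_min lexx.
have sg : s * (enorm g + 1) <= r / 2 by rewrite -ler_pdivlMr // ge_min lexx orbT.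
have E : p - s *: g - p = - (s *: g) by rewrite addrC addKr.
have Ab : A (p - s *: g).
  apply: pA; rewrite E enormN enormZ gtr0_norm //; lra.
have := le_trans (pmin _ Ab) (up _ Ab).
rewrite E dotpNr dotpZr -sqr_enorm enormN enormZ gtr0_norm // exprMn => h.
have q0 := sqr_ge0 (enorm g).
have h2 : s * enorm g ^+ 2 * (s * (L + 1)) <= s * enorm g ^+ 2 * 1.
  by rewrite ler_wpM2l // mulr_ge0 // ltW.
have h3 := mulr_ge0 (sqr_ge0 s) q0.
rewrite -(pmulr_rle0 _ s0); lra.
Qed.

End Projection.

(** Serves twice: with rate beta for the tracking error, then with rate [rho] for the regret. *)
Lemma cvg0_contracting_recurrence (R : realType) (r : R) (a d : nat -> R) :
  0 <= r < 1 -> (forall t, 0 <= a t) ->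
  (forall t, a t.+1 <= r * a t + d t) -> d @ \oo --> (0 : R) ->
  a @ \oo --> (0 : R).
Proof.
move=> /andP[r0 r1] a0 a_rec d_cvg; apply/cvgrPdist_le => e e0.
have q0 : 0 < 1 - r by rewrite subr_gt0.
have /cvgrPdist_le/(_ (e / 2 * (1 - r))) := d_cvg.
move=> /(_ _)[|N _ HN]; first by rewrite mulr_gt0 // divr_gt0.
(* Once [d] is at most [e / 2 * (1 - r)], the recurrence pulls [a] towards the fixed point
   [e / 2]. *)
have aN k : a (N + k)%N <= r ^+ k * a N + e / 2.
  elim: k => [|k IH]; first by rewrite addn0 expr0 mul1r lerDl ltW // divr_gt0.
  rewrite addnS; apply: le_trans (a_rec _) _.
  have := HN (N + k)%N (leq_addr _ _); rewrite /= sub0r normrN => h.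
  have h1 := le_trans (ler_norm _) h.
  have := ler_wpM2l r0 IH; rewrite exprS; lra.
have rk : (fun k => r ^+ k) @ \oo --> (0 : R).
  by apply: cvg_expr; rewrite ger0_norm.
have p0 : 0 < e / 2 / (1 + a N) by rewrite !divr_gt0 // ltr_wpDr.
have /cvgrPdist_le/(_ _ p0)[K _ HK] := rk.
exists (N + K)%N => // t /= Kt.
rewrite sub0r normrN ger0_norm //.
have -> : t = (N + (t - N))%N by rewrite subnKC // (leq_trans (leq_addr _ _) Kt).
apply: le_trans (aN _) _.
have /HK : (K <= t - N)%N by lia.
rewrite /= sub0r normrN ger0_norm ?exprn_ge0 // ler_pdivlMr ?ltr_wpDr //.
have := exprn_ge0 (t - N)%N r0; lra.
Qed.

(** * Equilibria *)

(** The constants are weakened to a common pair [mu], [L], so that both blocks share the middle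
    slope [(L + mu) / 2], as the staircase estimate requires. *)
Lemma smooth_strongly_convex_slice (R : realType) (n : nat) (A : set 'rV[R]_n)
    (phi : 'rV[R]_n -> R) (g : 'rV[R]_n -> 'rV[R]_n) (c : 'rV[R]_n)
    (mu mu' L L' r : R) :
  0 <= mu -> mu <= mu' -> mu <= L -> L' <= L ->
  convex_set A -> 0 < r -> (forall z, enorm (z - c) < r -> A z) ->
  gradient_on A phi g -> strongly_convex mu' A phi ->
  (forall a b, A a -> A b -> enorm (g a - g b) <= L' * enorm (a - b)) ->
  [/\ forall a b, A a -> A b ->
        `|phi b - phi a - dotp (g a) (b - a)| <= L / 2 * enorm (b - a) ^+ 2,
      forall a b, A a -> A b ->
        enorm (g b - g a - ((L + mu) / 2) *: (b - a))
        <= (L - mu) / 2 * enorm (b - a)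
    & forall a b, A a -> A b -> enorm (g a - g b) <= L * enorm (a - b)].
Proof.
move=> mu0 mu_le muL L_le cA r0 cr phi_g sc g_lip'.
have g_lip a b : A a -> A b -> enorm (g a - g b) <= L * enorm (a - b).
  move=> Aa Ab; apply: le_trans (g_lip' _ _ Aa Ab) _.
  by rewrite ler_wpM2r ?enorm_ge0.
have quad a b : A a -> A b ->
    `|phi b - phi a - dotp (g a) (b - a)| <= L / 2 * enorm (b - a) ^+ 2.
  move=> Aa Ab; apply: (gradient_quadratic phi_g g_lip) => s s01.
  exact: convex_setE.
split=> //; apply: (cocoercive_gradient mu0 muL _ _ g_lip cA r0 cr (phi := phi)).
  by move=> a b Aa Ab; have := quad a b Aa Ab; rewrite ler_norml; lra.
move=> a b Aa Ab.
have seg (s : R) : 0 <= s <= 1 -> A (a + s *: (b - a)) by exact: convex_setE.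
apply: le_trans (strongly_convex_gradient (le_trans mu0 mu_le) seg phi_g sc).
by rewrite lerD2l ler_wpM2r ?sqr_ge0 // ler_pM2r.
Qed.

Section Equilibrium.
Context {R : realType} {m n : nat}.
Variables (X : set 'rV[R]_m) (Y : set 'rV[R]_n).
Variables (f : 'rV[R]_m * 'rV[R]_n -> R).
Variables (gx : 'rV[R]_m * 'rV[R]_n -> 'rV[R]_m).
Variables (gy : 'rV[R]_m * 'rV[R]_n -> 'rV[R]_n).
Variables (mu_x mu_y Lx Ly Lxy Lyx : R) (xs : 'rV[R]_m) (ys : 'rV[R]_n).
Hypothesis X_convex : convex_set X.
Hypothesis Y_convex : convex_set Y.
Hypothesis mu_x_gt0 : 0 < mu_x.
Hypothesis mu_y_gt0 : 0 < mu_y.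
Hypothesis f_strong : strongly_convex_concave mu_x mu_y X Y f.
Hypothesis Lx_ge : mu_x <= Lx.
Hypothesis f_smooth : smooth_on X Y f gx gy Lx Ly.
Hypothesis Lxy_gt0 : 0 < Lxy.
Hypothesis f_cross : cross_lipschitz X Y gx gy Lxy Lyx.
Hypothesis nash : is_nash X Y f xs ys.
Hypothesis nash_interior : interior (X `*` Y) (xs, ys).

Local Notation mu := (Num.min mu_x mu_y).
Local Notation L := (Num.max Lx Ly).
Local Notation Lc := (Num.max Lxy Lyx).

Let mu_gt0 : 0 < mu. Proof. by rewrite lt_min mu_x_gt0. Qed.

Let mu_le_L : mu <= L.
Proof.
by apply: (@le_trans _ _ mu_x); [rewrite ge_min lexx | rewrite le_max Lx_ge].
Qed.

Let L_ge0 : 0 <= L. Proof. exact: le_trans (ltW mu_gt0) mu_le_L. Qed.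

(** Gives the inner ball of each factor needed for cocoercivity and for the vanishing of the
    equilibrium gradients. *)
Let nash_ball : exists2 r, 0 < r &
  (forall z, enorm (z - xs) < r -> X z) /\ (forall z, enorm (z - ys) < r -> Y z).
Proof.
move: nash_interior => /nbhs_ballP[r /= r0 H]; exists r => //.
have [Xxs Yys _] := nash; split=> z zr.
  have [] // : (X `*` Y) (z, ys).
  apply: H; split => /=; last exact: ballxx.
  rewrite -ball_normE /ball_ /= distrC.
  exact: le_lt_trans (norm_le_enorm _) zr.
have [] // : (X `*` Y) (xs, z).
apply: H; split => /=; first exact: ballxx.
rewrite -ball_normE /ball_ /= distrC.
exact: le_lt_trans (norm_le_enorm _) zr.
Qed.

Let slice_x y : Y y ->
  [/\ forall a b, X a -> X b ->
        `|f (b, y) - f (a, y) - dotp (gx (a, y)) (b - a)|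
        <= L / 2 * enorm (b - a) ^+ 2,
      forall a b, X a -> X b ->
        enorm (gx (b, y) - gx (a, y) - ((L + mu) / 2) *: (b - a))
        <= (L - mu) / 2 * enorm (b - a)
    & forall a b, X a -> X b ->
        enorm (gx (a, y) - gx (b, y)) <= L * enorm (a - b)].
Proof.
move=> Yy; have [r r0 [Xr _]] := nash_ball; have [grad gx_lip _] := f_smooth.
apply: (@smooth_strongly_convex_slice R m X (fun x => f (x, y))
  (fun x => gx (x, y)) xs mu mu_x L Lx r (ltW mu_gt0) _ mu_le_L _ X_convex r0 Xr).
- by rewrite ge_min lexx.
- by rewrite le_max lexx.
- exact: (gradient_on_fst grad Yy).
- exact: f_strong.1.
- by move=> a b Xa Xb; exact: gx_lip.
Qed.

Let slice_y x : X x ->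
  [/\ forall a b, Y a -> Y b ->
        `|- f (x, b) - - f (x, a) - dotp (- gy (x, a)) (b - a)|
        <= L / 2 * enorm (b - a) ^+ 2,
      forall a b, Y a -> Y b ->
        enorm (- gy (x, b) - - gy (x, a) - ((L + mu) / 2) *: (b - a))
        <= (L - mu) / 2 * enorm (b - a)
    & forall a b, Y a -> Y b ->
        enorm (- gy (x, a) - - gy (x, b)) <= L * enorm (a - b)].
Proof.
move=> Xx; have [r r0 [_ Yr]] := nash_ball; have [grad _ gy_lip] := f_smooth.
apply: (@smooth_strongly_convex_slice R n Y (fun y => - f (x, y))
  (fun y => - gy (x, y)) ys mu mu_y L Ly r (ltW mu_gt0) _ mu_le_L _ Y_convex r0 Yr).
- by rewrite ge_min lexx orbT.
- by rewrite le_max lexx orbT.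
- by apply: gradient_onN; exact: (gradient_on_snd grad Xx).
- exact: f_strong.2.
- by move=> a b Ya Yb; rewrite -opprD enormN; exact: gy_lip.
Qed.

Lemma nash_gradient0 : gx (xs, ys) = 0 /\ gy (xs, ys) = 0.
Proof.
have [r r0 [Xr Yr]] := nash_ball; have [Xxs Yys ns] := nash; split.
  have [quad _ _] := slice_x Yys.
  apply: (interior_min_gradient0 L_ge0 r0 Xr (phi := fun x => f (x, ys))) => b Xb.
    by have := quad _ _ Xxs Xb; rewrite ler_norml; lra.
  by have [] := ns b ys Xb Yys.
apply/eqP; rewrite -oppr_eq0; apply/eqP.
have [quad _ _] := slice_y Xxs.
apply: (interior_min_gradient0 L_ge0 r0 Yr (phi := fun y => - f (xs, y))) => b Yb.
  by have := quad _ _ Yys Yb; rewrite ler_norml; lra.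
by have [] := ns xs b Xxs Yb; rewrite lerN2.
Qed.

(** Inserting [f (xs, ys)] splits the gap into two terms, each nonnegative by equilibrium and at
    most quadratic because the gradients vanish there. *)
Lemma nash_gap x y : X x -> Y y ->
  0 <= f (x, ys) - f (xs, y)
    <= L / 2 * (enorm (x - xs) ^+ 2 + enorm (y - ys) ^+ 2).
Proof.
move=> Xx Yy; have [Xxs Yys ns] := nash; have [gx0 gy0] := nash_gradient0.
have [ns1 ns2] := ns x y Xx Yy.
have [qx _ _] := slice_x Yys; have [qy _ _] := slice_y Xxs.
have := qx _ _ Xxs Xx; have := qy _ _ Yys Yy.
rewrite gx0 gy0 oppr0 !dotp0l !ler_norml => /andP[_ h1] /andP[_ h2].
by apply/andP; split; lra.
Qed.

Lemma nash_contraction alpha x y : 0 <= alpha -> X x -> Y y ->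
  enorm (x - alpha *: gx (x, y) - xs) ^+ 2
  + enorm (y + alpha *: gy (x, y) - ys) ^+ 2
  <= contraction_factor mu L Lc alpha
     * (enorm (x - xs) ^+ 2 + enorm (y - ys) ^+ 2).
Proof.
move=> al0 Xx Yy; have [Xxs Yys _] := nash; have [gx0 gy0] := nash_gradient0.
have Lc0 : 0 <= Lc by rewrite le_max (ltW Lxy_gt0).
have W0 : 0 <= enorm (x - xs) ^+ 2 + enorm (y - ys) ^+ 2.
  by rewrite addr_ge0 // sqr_ge0.
have := @descent_ascent_contraction R m n X Y f gx gy mu L Lc alpha L_ge0 mu_le_L
  Lc0 al0.
move=> /(_ _ _ _ _ _ _ _ _ X_convex Y_convex xs x ys y Xxs Xx Yys Yy) H.
have {}H := H _ _ _ _ _ _ _ _.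
rewrite -(sqr_sqrtr W0) contraction_factorE -exprMn -sqr_enorm_row_mx.
rewrite ler_pXn2r ?nnegrE ?enorm_ge0 //; last first.
  rewrite mulr_ge0 ?sqrtr_ge0 // addr_ge0 ?sqrtr_ge0 // mulr_ge0 //.
  by rewrite divr_ge0 // subr_ge0.
rewrite gx0 gy0 !subr0 in H.
rewrite addrAC (addrAC y); apply: H.
- by move=> a a' b Xa Xa' Yb; have [q _ _] := slice_x Yb; apply: q.
- move=> a b b' Xa Yb Yb'; have [q _ _] := slice_y Xa.
  by have := q _ _ Yb Yb'; rewrite dotpNl -!opprD normrN.
- by move=> a a' b Xa Xa' Yb; have [_ q _] := slice_x Yb; apply: q.
- move=> a b b' Xa Yb Yb'; have [_ q _] := slice_y Xa.
  by have := q _ _ Yb Yb'; rewrite opprK (addrC (- _)).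
- move=> a b b' Xa Yb Yb'; apply: le_trans (f_cross.1 _ _ _ Xa Yb' Yb) _.
  by rewrite ler_wpM2r ?enorm_ge0 // le_max lexx.
- move=> a a' b Xa Xa' Yb; apply: le_trans (f_cross.2 _ _ _ Xa' Xa Yb) _.
  by rewrite ler_wpM2r ?enorm_ge0 // le_max lexx orbT.
- by move=> a a' b Xa Xa' Yb; have [_ _ q] := slice_x Yb; apply: q.
- move=> a b b' Xa Yb Yb'; have [_ _ q] := slice_y Xa.
  by have := q _ _ Yb' Yb; rewrite -opprD enormN.
Qed.

End Equilibrium.

(** * One-step tracking, discounted sums and the regret bound *)

Lemma is_proj_tracking (R : realType) (n : nat) (A : set 'rV[R]_n)
    (w z p a a' : 'rV[R]_n) (eta : R) :
  convex_set A -> compact A -> is_proj A z p -> A a -> enorm (z - w) <= eta ->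
  enorm (p - a') ^+ 2 <= enorm (w - a) ^+ 2
    + 2 * diameter A * (eta + enorm (a' - a)) + enorm (a' - a) ^+ 2.
Proof.
move=> cA kA pA Aa zw; have pD := enorm_le_diameter kA pA.1 Aa.
have pA' : is_proj A (w + (z - w)) p by rewrite addrC subrK.
have h := is_proj_dist cA pA' Aa zw pD.
(* The error is first measured from the old equilibrium [a]; passing to [a'] adds the cross term,
   bounded through the diameter, and the squared drift. *)
have tri : enorm (p - a') <= enorm (p - a) + enorm (a' - a).
  by rewrite (enormB a' a) -[p - a'](subrKA a); exact: enormD.
have t2 : enorm (p - a') ^+ 2 <= (enorm (p - a) + enorm (a' - a)) ^+ 2.
  by rewrite ler_pXn2r ?nnegrE ?addr_ge0 ?enorm_ge0.
have := ler_wpM2r (enorm_ge0 (a' - a)) pD.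
rewrite sqrrD in t2; lra.
Qed.

(** Discounted sums obey a one-step recurrence; this unrolls the tracking bound and makes the regret
    a contracting recurrence. *)
Lemma sum_geometric_recl (R : realType) (b : R) (d : nat -> R) (t : nat) :
  \sum_(1 <= i < t.+2) b ^+ (t.+1 - i) * d i
  = b * (\sum_(1 <= i < t.+1) b ^+ (t - i) * d i) + d t.+1.
Proof.
rewrite big_nat_recr //= subnn expr0 mul1r; congr (_ + _).
rewrite mulr_sumr; apply: eq_big_nat => i /andP[_ it].
by rewrite subSn // exprS mulrA.
Qed.

Lemma exchange_big_triangle (R : realType) (F : nat -> nat -> R) (T : nat) :
  \sum_(1 <= t < T.+1) \sum_(1 <= i < t.+1) F t i
  = \sum_(1 <= i < T.+1) \sum_(i <= t < T.+1) F t i.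
Proof.
transitivity (\sum_(1 <= t < T.+1) \sum_(1 <= i < T.+1 | (i <= t)%N) F t i).
  by apply: eq_big_nat => t /andP[_ tT]; rewrite (big_nat_widen _ _ T.+1).
rewrite (exchange_big_dep_nat xpredT) //=.
apply: eq_big_nat => i /andP[i1 _].
by rewrite [RHS](big_nat_widenl _ 1).
Qed.

Theorem theorem3 (R : realType) (nx ny : nat)
  (nx_gt0 : (0 < nx)%N) (ny_gt0 : (0 < ny)%N)
  (X : set 'rV[R]_nx) (Y : set 'rV[R]_ny)
  (f : nat -> 'rV[R]_nx * 'rV[R]_ny -> R)
  (gx : nat -> 'rV[R]_nx * 'rV[R]_ny -> 'rV[R]_nx)
  (gy : nat -> 'rV[R]_nx * 'rV[R]_ny -> 'rV[R]_ny)
  (mu_x mu_y Lx Ly Lxy Lyx dbar_x dbar_y : R)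
  (* (A1) *)
  (X_neq0 : X !=set0) (Y_neq0 : Y !=set0)
  (X_compact : compact X) (Y_compact : compact Y)
  (X_convex : convex_set X) (Y_convex : convex_set Y)
  (f_continuous : forall t, {within X `*` Y, continuous (f t)})
  (f_convex_concave : forall t, convex_concave X Y (f t))
  (* (A2) *)
  (mu_x_gt0 : 0 < mu_x) (mu_y_gt0 : 0 < mu_y)
  (f_strong : forall t, strongly_convex_concave mu_x mu_y X Y (f t))
  (* (A3) *)
  (Lx_ge : mu_x <= Lx) (Ly_ge : mu_y <= Ly)
  (f_smooth : forall t, smooth_on X Y (f t) (gx t) (gy t) Lx Ly)
  (* (A4) *)
  (Lxy_gt0 : 0 < Lxy) (Lyx_gt0 : 0 < Lyx)
  (f_cross : forall t, cross_lipschitz X Y (gx t) (gy t) Lxy Lyx)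
  (* (A5) *)
  (dbar_x_gt0 : 0 < dbar_x) (dbar_y_gt0 : 0 < dbar_y)
  (f_smooth_expanded : forall t,
     smooth_on (expand X dbar_x) (expand Y dbar_y) (f t) (gx t) (gy t) Lx Ly)
  (* interior Nash equilibria *)
  (xs : nat -> 'rV[R]_nx) (ys : nat -> 'rV[R]_ny)
  (nash : forall t, is_nash X Y (f t) (xs t) (ys t))
  (nash_interior : forall t, interior (X `*` Y) (xs t, ys t))
  (* parameters and algorithm *)
  (rho alpha : R) (rho_gt0 : 0 < rho) (rho_lt1 : rho < 1)
  (c delta : nat -> R) (x : nat -> 'rV[R]_nx) (y : nat -> 'rV[R]_ny) :
  let mu := Num.min mu_x mu_y in
  let L := Num.max Lx Ly in
  let Lc := Num.max Lxy Lyx in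
  let DX := diameter X in
  let DY := diameter Y in
  let Vx := variation xs in
  let Vy := variation ys in
  let beta := contraction_factor mu L Lc alpha in
  let E0 := enorm (x 0%N - xs 0%N) ^+ 2 + enorm (y 0%N - ys 0%N) ^+ 2 in
  let drift := fun i : nat =>
    2 * DX * (alpha * c i.-1 + Vx i) + 2 * DY * (alpha * c i.-1 + Vy i)
    + 2 * alpha ^+ 2 * c i.-1 ^+ 2 + Vx i ^+ 2 + Vy i ^+ 2 in
  let RF := forgetting_regret f rho x xs y ys in
  0 < alpha -> alpha < 2 * mu / (mu * L + Lc ^+ 2) ->
  (forall t, 0 < c t) ->
  (forall t, delta t =
     Num.min (Num.min (c t / (nx%:R * Lx)) (c t / (ny%:R * Ly)))
             (Num.min dbar_x dbar_y)) ->
  X (x 0%N) -> Y (y 0%N) ->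
  (forall t, is_proj X (x t - alpha *: diff_x (f t) (delta t) (x t) (y t))
                       (x t.+1)) ->
  (forall t, is_proj Y (y t + alpha *: diff_y (f t) (delta t) (x t) (y t))
                       (y t.+1)) ->
  [/\ forall t : nat,
        enorm (x t - xs t) ^+ 2 + enorm (y t - ys t) ^+ 2
        <= beta ^+ t * E0 + \sum_(1 <= i < t.+1) beta ^+ (t - i) * drift i,
      forall T : nat, (1 <= T)%N ->
        RF T <= L / 2 * \sum_(1 <= t < T.+1) rho ^+ (T - t) * beta ^+ t * E0
              + L / 2 * \sum_(1 <= i < T.+1) \sum_(i <= t < T.+1)
                          rho ^+ (T - t) * beta ^+ (t - i) * drift i
    & c @ \oo --> (0 : R) -> Vx @ \oo --> (0 : R) -> Vy @ \oo --> (0 : R) ->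
      RF @ \oo --> (0 : R)].
Proof.
move=> mu L Lc DX DY Vx Vy beta E0 drift RF al0 al_lt c0 dE X0 Y0 px py.
pose E t := enorm (x t - xs t) ^+ 2 + enorm (y t - ys t) ^+ 2.
have Xx t : X (x t) by case: t => [//|t]; exact: (px t).1.
have Yy t : Y (y t) by case: t => [//|t]; exact: (py t).1.
have Lx0 : 0 < Lx by exact: lt_le_trans Lx_ge.
have Ly0 : 0 < Ly by exact: lt_le_trans Ly_ge.
have mu0 : 0 < mu by rewrite lt_min mu_x_gt0.
have muL : mu <= L.
  by apply: (@le_trans _ _ mu_x); [rewrite ge_min lexx | rewrite le_max Lx_ge].
have nxL : 0 < nx%:R * Lx by rewrite mulr_gt0 // ltr0n.
have nyL : 0 < ny%:R * Ly by rewrite mulr_gt0 // ltr0n.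
have beta0 : 0 <= beta by exact: contraction_factor_ge0.
have beta1 : beta < 1 by exact: contraction_factor_lt1.
have d0 t : 0 < delta t.
  by rewrite dE !lt_min dbar_x_gt0 dbar_y_gt0 !divr_gt0.
have hx_err t :
    enorm (diff_x (f t) (delta t) (x t) (y t) - gx t (x t, y t)) <= c t.
  have [grad gx_lip _] := f_smooth_expanded t.
  have Yyt : expand Y dbar_y (y t) by apply: sub_expand.
  apply: (central_difference_error nx_gt0 Lx0 (d0 t) _ _
    (gradient_on_fst grad Yyt) _ (Xx t)).
  - by rewrite dE !ge_min lexx !orbT.
  - by rewrite dE !ge_min lexx.
  - by move=> a b Xa Xb; exact: gx_lip.
have hy_err t :
    enorm (diff_y (f t) (delta t) (x t) (y t) - gy t (x t, y t)) <= c t.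
  have [grad _ gy_lip] := f_smooth_expanded t.
  have Xxt : expand X dbar_x (x t) by apply: sub_expand.
  apply: (central_difference_error ny_gt0 Ly0 (d0 t) _ _
    (gradient_on_snd grad Xxt) _ (Yy t)).
  - by rewrite dE !ge_min lexx !orbT.
  - by rewrite dE !ge_min lexx !orbT.
  - by move=> a b Ya Yb; exact: gy_lip.
(* The exact step contracts towards the equilibrium at time [t], and [is_proj_tracking] adds the
   difference error and the move to the next equilibrium. The index [i.-1] in [drift] makes [c t]
   appear in [drift t.+1]. *)
have step t : E t.+1 <= beta * E t + drift t.+1.
  have [Xs Ys _] := nash t.
  have contr := nash_contraction X_convex Y_convex mu_x_gt0 mu_y_gt0 (f_strong t)
    Lx_ge (f_smooth t) Lxy_gt0 (f_cross t) (nash t)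
    (nash_interior t) (ltW al0) (Xx t) (Yy t).
  have b_x := @is_proj_tracking _ _ X (x t - alpha *: gx t (x t, y t)) _ _ _
    (xs t.+1) (alpha * c t) X_convex X_compact (px t) Xs.
  have b_y := @is_proj_tracking _ _ Y (y t + alpha *: gy t (x t, y t)) _ _ _
    (ys t.+1) (alpha * c t) Y_convex Y_compact (py t) Ys.
  apply: le_trans (lerD (b_x _) (b_y _)) _.
  - rewrite opprB addrC addrA subrK -scalerBr enormZ gtr0_norm //.
    by rewrite ler_pM2l // enormB.
  - rewrite opprD addrACA subrr add0r -scalerBr enormZ gtr0_norm //.
    by rewrite ler_pM2l.
  - have sq : 0 <= 2 * alpha ^+ 2 * c t ^+ 2 by rewrite -mulrA mulr_ge0 // mulr_ge0 ?sqr_ge0.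
    rewrite /drift /Vx /Vy /variation /= /E.
    move: contr sq; rewrite -/mu -/L -/Lc -/beta -/DX -/DY; lra.
have track t :
    E t <= beta ^+ t * E0 + \sum_(1 <= i < t.+1) beta ^+ (t - i) * drift i.
  elim: t => [|t IH]; first by rewrite expr0 mul1r big_geq // addr0.
  rewrite sum_geometric_recl exprS -mulrA addrA -mulrDr.
  by apply: le_trans (step t) _; rewrite lerD2r ler_wpM2l.
have gap t := nash_gap X_convex Y_convex mu_x_gt0 mu_y_gt0 (f_strong t)
    Lx_ge (f_smooth t) (nash t) (nash_interior t) (Xx t) (Yy t).
have gap_ge0 t : 0 <= f t (x t, ys t) - f t (xs t, y t).
  by have /andP[] := gap t.
have gap_le t : f t (x t, ys t) - f t (xs t, y t) <= L / 2 * E t.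
  by have /andP[] := gap t.
have L2 : 0 <= L / 2 by rewrite divr_ge0 // (le_trans (ltW mu0)).
split=> [//|T T1|c_cvg Vx_cvg Vy_cvg].
(* With the double sum summed over [i] first, the claim reduces to the gap and tracking bounds for
   each [t]. *)
- rewrite -exchange_big_triangle -mulrDr -big_split mulr_sumr /=.
  apply: ler_sum_nat => t _.
  under eq_bigr do rewrite -mulrA.
  rewrite -mulr_sumr -(mulrA _ _ E0) -mulrDr mulrCA ler_wpM2l ?exprn_ge0 ?(ltW rho_gt0) //.
  apply: le_trans (gap_le t) _; rewrite ler_wpM2l //; exact: track.
- have E_cvg : E @ \oo --> (0 : R).
    apply: (@cvg0_contracting_recurrence R beta E (fun t => drift t.+1)).
    + by rewrite beta0.
    + by move=> t; rewrite addr_ge0 // sqr_ge0.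
    + exact: step.
    + have V1 : (fun t => Vx t.+1) @ \oo --> (0 : R) by rewrite cvg_shiftS.
      have V2 : (fun t => Vy t.+1) @ \oo --> (0 : R) by rewrite cvg_shiftS.
      have ac : (fun t => alpha * c t) @ \oo --> alpha * 0.
        by apply: cvgM => //; exact: cvg_cst.
      have -> : (0 : R) = 2 * DX * (alpha * 0 + 0) + 2 * DY * (alpha * 0 + 0)
          + 2 * alpha ^+ 2 * (0 * 0) + 0 * 0 + 0 * 0 by ring.
      rewrite /drift /=; apply: cvgD; [|exact: (cvgM V2 V2)].
      apply: cvgD; [|exact: (cvgM V1 V1)].
      apply: cvgD; [apply: cvgD|].
      * by apply: cvgM; [exact: cvg_cst | exact: cvgD].
      * by apply: cvgM; [exact: cvg_cst | exact: cvgD].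
      * by apply: cvgM; [exact: cvg_cst | exact: (cvgM c_cvg c_cvg)].
  (* The regret at [t + 1] is [rho] times the regret at [t] plus the new gap, which vanishes with
     the tracking error. *)
  apply: (@cvg0_contracting_recurrence R rho RF (fun t => L / 2 * E t.+1)).
  + by rewrite (ltW rho_gt0).
  + move=> t; apply: sumr_ge0 => i _.
    by rewrite mulr_ge0 ?exprn_ge0 ?(ltW rho_gt0).
  + move=> t; rewrite /RF /forgetting_regret sum_geometric_recl lerD2l.
    exact: gap_le.
  + have -> : (0 : R) = L / 2 * 0 by rewrite mulr0.
    by apply: cvgM; [exact: cvg_cst | rewrite cvg_shiftS].
Qed.
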